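(* In the Coxeter tessellation $\widetilde{B}_3$ the minimal stick number is at most $40$; that is, $l(\widetilde{B}_3)\le 40$.
   Context: The tessellation $\widetilde{B}_3$: start from the standard tessellation of $\mathbb{R}^3$ by unit cubes and divide each cube into $24$ pyramids (tetrahedra), each being the convex hull of the center of the cube, the center of one of its faces, and the two endpoints of one edge of that face. Vertices are colored: cube centers have color $D$, centers of cube faces have color $C$, and vertices of the cubes have colors $A$ and $B$ in alternating fashion (the two endpoints of every cube edge have different colors). Every pyramid thus has exactly one vertex of each color $A,B,C,D$. A gallery is a path of pyramids such that consecutive pyramids share a (two-dimensional) face. Once a starting pyramid is chosen, a gallery is encoded by a word $(s_1,\dots,s_k)$ with $s_i\in\{A,B,C,D\}$: at step $i$ one passes from the current pyramid to the adjacent pyramid across the face opposite to the vertex of color $s_i$. The length of the gallery is $k$. The gallery is closed if after step $k$ one is back at the starting pyramid. A closed gallery knots as a knot $K$ if the closed polygonal curve obtained by joining consecutive centers (barycenters) of its pyramids has no self-intersections and is a knot of the same type as $K$. For a knot $K$, $l_{\widetilde{B}_3}(K)$ is the minimal length of a closed gallery in $\widetilde{B}_3$ that knots as $K$. The minimal stick number of $\widetilde{B}_3$ is $l(\widetilde{B}_3)=\min\{l_{\widetilde{B}_3}(K)\mid K\neq 0_1\}$, where $0_1$ denotes the unknot, i.e. the minimal length of a closed gallery that knots in a nontrivial way. *)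

(* Defs.v *)
(* MathComp / MathComp-Analysis; R^3 is 'rV[R]_3 with R : realType. *)
From mathcomp Require Import all_boot all_order all_algebra.
From mathcomp Require Import all_classical all_reals all_analysis.
Set Implicit Arguments.
Unset Strict Implicit.
Unset Printing Implicit Defensive.
Import Order.TTheory GRing.Theory Num.Theory.
Import numFieldNormedType.Exports.
Local Open Scope classical_set_scope.
Local Open Scope ring_scope.

Inductive color := colA | colB | colC | colD.

(* A pyramid is given by its four vertices, indexed by their colors; the solid
   pyramid is their convex hull. *)
Definition pyramid (R : realType) := color -> 'rV[R]_3.

(* [z, a, e] encodes the face x_a = z_a + e of the unit cube z + [0,1]^3. *)
Definition cube_center (R : realType) (z : 'rV[int]_3) : 'rV[R]_3 :=
  \row_j ((z 0 j)%:~R + 2^-1).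

Definition face_center (R : realType) (z : 'rV[int]_3) (a : 'I_3) (e : bool)
    : 'rV[R]_3 :=
  \row_j ((z 0 j)%:~R + (if j == a then e%:R else 2^-1)).

Definition face_corner (z : 'rV[int]_3) (a : 'I_3) (e : bool)
    (x : 'rV[int]_3) : Prop :=
  x 0 a = z 0 a + e%:R /\ forall j, x 0 j = z 0 j \/ x 0 j = z 0 j + 1.

Definition face_edge (z : 'rV[int]_3) (a : 'I_3) (e : bool)
    (x y : 'rV[int]_3) : Prop :=
  [/\ face_corner z a e x, face_corner z a e y
    & #|[set j | x 0 j != y 0 j]%SET| = 1%N].

(* The alternating coloring of the cube vertices: A for even coordinate sum,
   B for odd coordinate sum. *)
Definition even_point (x : 'rV[int]_3) : bool := (2 %| \sum_j x 0 j)%Z.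

Definition in_B3 (R : realType) (v : pyramid R) : Prop :=
  exists (z : 'rV[int]_3) (a : 'I_3) (e : bool) (x y : 'rV[int]_3),
    [/\ face_edge z a e x y, even_point x && ~~ even_point y,
        v colA = map_mx intr x /\ v colB = map_mx intr y,
        v colC = face_center R z a e
      & v colD = cube_center R z].

(* [q] is the other pyramid sharing with [p] the face opposite to the vertex
   of color [s]. *)
Definition adjacent_across (R : realType) (s : color) (p q : pyramid R) : Prop :=
  q s <> p s /\ forall c, c <> s -> q c = p c.

(* The pyramids of a gallery of length [k = size w] are [p 0, ..., p k];
   later values of [p] are irrelevant. *)
Definition gallery (R : realType) (w : seq color) (p : nat -> pyramid R) : Prop :=
  (forall i, (i <= size w)%N -> in_B3 (p i)) /\
  (forall i, (i < size w)%N -> adjacent_across (nth colA w i) (p i) (p i.+1)).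

Definition closed_gallery (R : realType) (w : seq color) (p : nat -> pyramid R)
    : Prop :=
  gallery w p /\ p (size w) = p 0%N.

Definition barycenter (R : realType) (v : pyramid R) : 'rV[R]_3 :=
  4^-1 *: (v colA + v colB + v colC + v colD).

Definition edge_point (R : realType) (b : nat -> 'rV[R]_3) (i : nat) (t : R)
    : 'rV[R]_3 :=
  (1 - t) *: b i + t *: b i.+1.

(* The polygonal curve with vertices [b 0, ..., b n], each edge taken without
   its final endpoint; nothing is lost when [b n = b 0]. *)
Definition polygon (R : realType) (n : nat) (b : nat -> 'rV[R]_3)
    : set 'rV[R]_3 :=
  [set x | exists (i : nat) (t : R), [/\ (i < n)%N, 0 <= t < 1 & x = edge_point b i t]].

(* The last clause is injectivity of the parametrization on R/nZ. *)
Definition simple_closed_polygon (R : realType) (n : nat) (b : nat -> 'rV[R]_3)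
    : Prop :=
  [/\ (0 < n)%N, b n = b 0%N
    & forall (i j : nat) (t u : R), (i < n)%N -> (j < n)%N ->
        0 <= t < 1 -> 0 <= u < 1 ->
        edge_point b i t = edge_point b j u -> i = j /\ t = u].

Definition homeomorphism (T U : topologicalType) (f : T -> U) : Prop :=
  continuous f /\
  exists g : U -> T, [/\ continuous g, cancel f g & cancel g f].

Definition ambient_isotopic (R : realType) (K L : set 'rV[R]_3) : Prop :=
  exists H : R -> 'rV[R]_3 -> 'rV[R]_3,
    [/\ {within [set tx : R * 'rV[R]_3 | 0 <= tx.1 <= 1],
           continuous (fun tx : R * 'rV[R]_3 => H tx.1 tx.2)},
        forall t : R, 0 <= t <= 1 -> homeomorphism (H t),
        forall x, H 0 x = x
      & H 1 @` K = L].

Definition unknot (R : realType) : set 'rV[R]_3 :=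
  [set x | x 0 0 ^+ 2 + x 0 1 ^+ 2 = 1 /\ x 0 2 = 0].

(* Tame knots; two knots have the same type when they are ambient isotopic. *)
Definition is_knot (R : realType) (K : set 'rV[R]_3) : Prop :=
  exists (n : nat) (b : nat -> 'rV[R]_3),
    simple_closed_polygon n b /\ ambient_isotopic (polygon n b) K.

Definition nontrivial_knot (R : realType) (K : set 'rV[R]_3) : Prop :=
  is_knot K /\ ~ ambient_isotopic K (@unknot R).

Definition knots_as (R : realType) (w : seq color) (p : nat -> pyramid R)
    (K : set 'rV[R]_3) : Prop :=
  let b := fun i => barycenter (p i) in
  simple_closed_polygon (size w) b /\ ambient_isotopic (polygon (size w) b) K.

Definition is_min (S : set nat) (m : nat) : Prop :=
  S m /\ forall n, S n -> (m <= n)%N.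

(* [is_stick_number K m] means that l(K) is defined and equal to [m]. *)
Definition is_stick_number (R : realType) (K : set 'rV[R]_3) (m : nat) : Prop :=
  is_min [set k | exists (w : seq color) (p : nat -> pyramid R),
                    [/\ closed_gallery w p, knots_as w p K & size w = k]] m.

(* [is_min_stick_number R l] means that the minimum of l(K) over the nontrivial
   knots K exists and equals [l]. *)
Definition is_min_stick_number (R : realType) (l : nat) : Prop :=
  is_min [set m | exists K : set 'rV[R]_3,
                    nontrivial_knot K /\ is_stick_number K m] l.

(* Main.v *)
(* An explicit gallery of length 40 traces a trefoil K; the point is that K is
   not ambient isotopic to the round circle U.  On the complement X of a closed
   set consider functions tau : X * X -> S_3 that satisfy
   tau a b * tau b c = tau a c for a, b, c close to any given point
   (Alexander-Spanier 1-cocycles, i.e. flat S_3-bundles); homeomorphisms carry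
   them along without further work.

   On the complement of U, tau is a coboundary on the star-shaped set
   {z <> 0 or x^2 + y^2 < 1}, and across the connected annulus
   {z = 0, x^2 + y^2 > 1} the primitive jumps by a constant c; so modulo the
   cyclic group <c> the bundle has a section.  On the complement of K, take the
   power diagram of the 26 tessellation vertices touched by the gallery.  Its
   cells are convex, K lies in its 1-skeleton, and constant transitions in S_3
   between cells define a cocycle, provided the cocycle condition holds for
   every triple of cells which meet outside K.  A section modulo <c> would force
   the holonomies around two edges of K, two distinct transpositions, into one
   conjugate of <c>, but they do not commute. *)
Require Import Defs.
From mathcomp Require Import all_boot all_order all_algebra all_fingroup.
From mathcomp Require Import all_classical all_reals all_analysis.
From mathcomp Require Import ring lra zify.
Set Implicit Arguments.
Unset Strict Implicit.
Unset Printing Implicit Defensive.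
Import Order.TTheory GRing.Theory Num.Theory.
Import numFieldNormedType.Exports.
Local Open Scope classical_set_scope.
Local Open Scope ring_scope.

(** * Nonabelian cocycles *)

(** Connectedness of [0, 1]: the local hypothesis makes the set where [P] holds both open and closed
    in the interval. *)
Lemma unit_interval_ind (R : realType) (P : R -> Prop) :
  P 0 ->
  (forall t, 0 <= t <= 1 -> exists2 e, 0 < e &
     forall s, 0 <= s <= 1 -> `|s - t| < e -> (P s <-> P t)) ->
  P 1.
Proof.
move=> P0 locP.
have I01 (t : R) : (`[0, 1]%classic t) = (0 <= t <= 1) by rewrite /= in_itv.
suff /seteqP[_ sub] : `[0, 1]%classic `&` P = `[0, 1]%classic.
  by have [|//] := sub 1; rewrite I01 lexx ler01.
apply: (@segment_connected R 0 1).
- by exists 0; split=> //; rewrite I01 lexx ler01.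
- exists (interior [set s | 0 <= s <= 1 -> P s]); first exact: open_interior.
  apply/seteqP; split=> s [Is Ps]; split=> //.
    rewrite I01 in Is; have [e e0 He] := locP _ Is.
    apply/nbhs_ballP; exists e => //= r; rewrite -ball_normE /= distrC => rs Ir.
    exact/(He _ Ir rs).
  by rewrite I01 in Is; apply: (nbhs_singleton Ps).
- exists (closure (`[0, 1]%classic `&` P)); first exact: closed_closure.
  apply/seteqP; split=> s [Is Ps]; split=> //; first by apply: subset_closure.
  rewrite I01 in Is; have [e e0 He] := locP _ Is.
  have [r [[Ir Pr] rs]] := Ps _ (nbhsx_ballx s e e0).
  rewrite I01 in Ir; apply/(He r) => //.
  by move: rs; rewrite -ball_normE /= distrC.
Qed.

(** Along the segment from [x] to [y], being related to [x] is a locally constant property, so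
    [unit_interval_ind] carries it across. Below, [C] is a half-ball, a half-plane or an open
    cell. *)
Lemma convex_locally_related (R : realType) (V : normedModType R)
    (C : set V) (E : V -> V -> Prop) :
  (forall x y t, C x -> C y -> 0 <= t <= 1 -> C (x + t *: (y - x))) ->
  (forall x, E x x) ->
  (forall x y, E x y -> E y x) -> (forall x y z, E x y -> E y z -> E x z) ->
  (forall x, C x -> exists2 e, 0 < e &
     forall y, C y -> `|y - x| < e -> E x y) ->
  forall x y, C x -> C y -> E x y.
Proof.
move=> cvx Erefl Esym Etrans locE x y Cx Cy.
suff : E x (x + 1 *: (y - x)) by rewrite scale1r addrC subrK.
apply: (unit_interval_ind (P := fun t => E x (x + t *: (y - x)))).
  by rewrite scale0r addr0.
move=> t It; have [e e0 He] := locE _ (cvx _ _ _ Cx Cy It).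
(* The added 1 keeps the denominator positive when [x] and [y] coincide. *)
have n0 : 0 < 1 + `|y - x| by apply: ltr_pwDl.
exists (e / (1 + `|y - x|)); first exact: divr_gt0.
move=> s Is; rewrite ltr_pdivlMr // => st.
have {}He : E (x + t *: (y - x)) (x + s *: (y - x)).
  apply: He; first exact: cvx.
  rewrite opprD addrACA subrr add0r -scalerBl normrZ.
  by apply: le_lt_trans st; rewrite ler_wpM2l // lerDr.
by split=> /Etrans; apply => //; exact: Esym.
Qed.

Definition local_cocycle (R : realType) (V : normedModType R)
    (gT : finGroupType) (X : set V) (tau : V -> V -> gT) : Prop :=
  forall x, X x -> exists2 e : R, 0 < e &
    forall a b c, X a -> X b -> X c ->
      `|a - x| < e -> `|b - x| < e -> `|c - x| < e ->
      (tau a b * tau b c)%g = tau a c.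

Lemma local_cocycleS (R : realType) (V : normedModType R)
    (gT : finGroupType) (X Y : set V) (tau : V -> V -> gT) :
  Y `<=` X -> local_cocycle X tau -> local_cocycle Y tau.
Proof.
move=> YX ctau x /YX Xx; have [e e0 He] := ctau x Xx; exists e => // a b c.
by move=> /YX ? /YX ? /YX ?; exact: He.
Qed.

(** * Cocycles on star-shaped sets *)

Section StarShaped.
Variables (R : realType) (V : normedModType R) (gT : finGroupType).
Variables (B : set V) (tau : V -> V -> gT).
Hypothesis starB : forall x (t : R), B x -> 0 <= t <= 1 -> B (t *: x).
Hypothesis ctau : local_cocycle B tau.

Definition cocycle_near x (e : R) := forall a b c, B a -> B b -> B c ->
  `|a - x| < e -> `|b - x| < e -> `|c - x| < e -> (tau a b * tau b c)%g = tau a c.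

(** Continuous induction on [s], the assertion being that one radius serves all parameters in
    [0, s]. *)
Lemma lebesgue_number x : B x -> exists2 e : R, 0 < e &
  forall t, 0 <= t <= 1 -> cocycle_near (t *: x) e.
Proof.
move=> Bx.
apply: (unit_interval_ind (P := fun s => exists2 e : R, 0 < e &
  forall t, 0 <= t <= s -> cocycle_near (t *: x) e)).
  have B0 : B 0 by rewrite -(scale0r x); apply: starB; rewrite // lexx ler01.
  have [e e0 He] := ctau B0; exists e => // t t0.
  have -> : t = 0 by lra.
  by rewrite scale0r.
move=> t It; have [e e0 He] := ctau (starB Bx It).
have n0 : 0 < 1 + `|x| by apply: ltr_pwDl.
have d0 : 0 < e / 2 / (1 + `|x|) by rewrite !divr_gt0.
have near_t (r : R) : `|r - t| < e / 2 / (1 + `|x|) -> cocycle_near (r *: x) (e / 2).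
  rewrite ltr_pdivlMr // => rt.
  have {}rt : `|r *: x - t *: x| < e / 2.
    rewrite -scalerBl normrZ; apply: le_lt_trans rt.
    by rewrite ler_wpM2l // lerDr.
  have far (a : V) : `|a - r *: x| < e / 2 -> `|a - t *: x| < e.
    move=> ar; have -> : a - t *: x = (a - r *: x) + (r *: x - t *: x).
      by rewrite addrA subrK.
    by apply: le_lt_trans (ler_normD _ _) _; lra.
  by move=> a b c Ba Bb Bc /far ? /far ? /far ?; apply: He.
exists (e / 2 / (1 + `|x|)) => //.
suff imp (s s' : R) : `|s - t| < e / 2 / (1 + `|x|) -> `|s' - t| < e / 2 / (1 + `|x|) ->
    (exists2 e : R, 0 < e & forall t, 0 <= t <= s -> cocycle_near (t *: x) e) ->
    (exists2 e : R, 0 < e & forall t, 0 <= t <= s' -> cocycle_near (t *: x) e).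
  move=> s _ st; have tt : `|t - t| < e / 2 / (1 + `|x|) by rewrite subrr normr0.
  by split; apply: imp.
(* Parameters up to [s] keep the radius [d]; those between [s] and [s'] are near [t], where [e / 2]
   works. *)
move=> st s't [d dgt0 Hd]; exists (Num.min d (e / 2)).
  by rewrite lt_min dgt0 divr_gt0.
move=> r /andP[r0 rs'].
have mono f f' y : f <= f' -> cocycle_near y f' -> cocycle_near y f.
  move=> ff Hf a b c Ba Bb Bc ay bY cy.
  by apply: Hf => //; apply: lt_le_trans ff.
have [rs|sr] := leP r s.
  by apply: (mono _ d); [rewrite ge_min lexx|apply: Hd; rewrite r0].
apply: (mono _ (e / 2)); first by rewrite ge_min lexx orbT.
apply: near_t; move: st s't; rewrite !ltr_norml => /andP[? ?] /andP[? ?].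
by apply/andP; split; lra.
Qed.

Definition grid (x : V) (N i : nat) : V := (i%:R / N%:R : R) *: x.

(* The product of [tau] along the [N]-th radial subdivision is unchanged by
   doubling [N] once all steps are shorter than a Lebesgue number. *)
Fixpoint hol (x : V) (N i : nat) : gT :=
  if i is j.+1 then (hol x N j * tau (grid x N j) (grid x N j.+1))%g
  else 1%g.

Lemma frac01 (N i : nat) : (i <= N)%N -> (0 < N)%N -> 0 <= (i%:R / N%:R : R) <= 1.
Proof.
move=> iN N0; rewrite divr_ge0 ?ler0n //= ler_pdivrMr ?ltr0n // mul1r.
by rewrite ler_nat.
Qed.

Lemma step_small x (N i : nat) (e : R) : `|x| < N%:R * e -> (0 < N)%N ->
  `|grid x N i.+1 - grid x N i| < e.
Proof.
move=> xN N0; rewrite /grid -scalerBl -mulrBl -natrB // subSnn normrZ.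
have N0' : 0 < N%:R :> R by rewrite ltr0n.
by rewrite div1r ger0_norm ?invr_ge0 ?ltW // mulrC ltr_pdivrMr // mulrC.
Qed.

(** Two consecutive half-steps merge into one full step by the cocycle identity near the point of
    parameter [i / N]. *)
Lemma hol_double x (e : R) (N : nat) : B x ->
  (forall t, 0 <= t <= 1 -> cocycle_near (t *: x) e) ->
  (0 < N)%N -> `|x| < N%:R * e -> hol x N.*2 N.*2 = hol x N N.
Proof.
move=> Bx He N0 xN.
have N2 : (0 < N.*2)%N by rewrite double_gt0.
have e0 : 0 < e.
  rewrite -(pmulr_rgt0 _ (x := N%:R)) ?ltr0n //.
  exact: le_lt_trans xN.
suff H i : (i <= N)%N -> hol x N.*2 i.*2 = hol x N i by exact: H.
elim: i => // i IHi iN; rewrite doubleS /= IHi 1?ltnW //.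
have half (j : nat) : grid x N.*2 j.*2 = grid x N j.
  by rewrite /grid -!muln2 !natrM -mulf_div divff ?mulr1 // pnatr_eq0.
rewrite -doubleS !half -mulgA; congr (_ * _)%g.
have small : `|x| < N.*2%:R * e.
  apply: lt_le_trans xN _; rewrite ler_wpM2r ?ler_nat ?ltW //.
  by rewrite -addnn leq_addr.
apply: (He (i%:R / N%:R)).
- by apply: frac01 => //; exact: ltnW.
- by apply: starB => //; apply: frac01 => //; exact: ltnW.
- by apply: starB => //; apply: frac01 => //; lia.
- by apply: starB => //; exact: frac01.
- by rewrite subrr normr0.
- by rewrite -/(grid x N i) -half; exact: step_small.
- exact: step_small.
Qed.

(** A ladder between the two radial segments, with rungs joining points of equal parameter. One side
    and one rung together are shorter than [e], so the cocycle identity holds on every square and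
    pushes the rung outwards from 0. *)
Lemma hol_compat x y (e : R) (N : nat) : B x -> B y ->
  (forall t, 0 <= t <= 1 -> cocycle_near (t *: x) e) ->
  (0 < N)%N -> `|x| < N%:R * (e / 2) -> `|y| < N%:R * (e / 2) -> `|y - x| < e / 2 ->
  (hol x N N * tau x y)%g = hol y N N.
Proof.
move=> Bx By He N0 xN yN xy.
have e0 : 0 < e.
  have : 0 < e / 2 by apply: le_lt_trans xy.
  lra.
suff H i : (i <= N)%N -> (hol x N i * tau (grid x N i) (grid y N i))%g = hol y N i.
  have := H N (leqnn _).
  by rewrite /grid divff ?pnatr_eq0 -?lt0n // !scale1r.
have close (t : R) : 0 <= t <= 1 -> `|t *: y - t *: x| < e / 2.
  move=> /andP[t0 t1]; rewrite -scalerBr normrZ ger0_norm //.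
  by apply: le_lt_trans xy; rewrite ler_piMl.
elim: i => [_|i IHi iN] /=.
  (* At the origin the rung is [tau 0 0], which the cocycle identity at (0, 0, 0) forces to be 1. *)
  rewrite /grid mul0r !scale0r mul1g.
  have B0 : B 0 by rewrite -(scale0r x); apply: starB; rewrite // lexx ler01.
  have [d d0 /(_ 0 0 0)] := ctau B0; rewrite subrr normr0 => /(_ B0 B0 B0 d0 d0 d0).
  by move/(congr1 (fun g => (tau 0 0)^-1 * g)%g); rewrite mulKg mulVg.
have iN' := ltnW iN.
have fi := frac01 iN' N0; have fSi := frac01 iN N0.
rewrite -IHi // -!mulgA; congr (_ * _)%g.
set a := grid x N i; set a' := grid x N _; set b := grid y N i; set b' := grid y N _.
have [Ba Ba' Bb Bb'] : [/\ B a, B a', B b & B b'] by split; apply: starB.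
have aa : `|a - a| < e by rewrite subrr normr0.
have a'a : `|a' - a| < e by apply: lt_trans (step_small _ xN N0) _; lra.
have ba : `|b - a| < e by apply: lt_trans (close _ fi) _; lra.
have b'a : `|b' - a| < e.
  have -> : b' - a = (b' - b) + (b - a) by rewrite addrA subrK.
  apply: le_lt_trans (ler_normD _ _) _.
  by have := close _ fi; have := step_small i yN N0; rewrite -/b -/b' -/a; lra.
by rewrite (He _ fi a a' b') // (He _ fi a b b').
Qed.

(** The primitive integrates [tau] along radii: [f x] is the eventual value of the products over
    [2 ^ n] steps. Successive powers of two are doublings, so [hol_double] makes them eventually
    constant, and [hol_compat] compares neighbouring radii. *)
Lemma star_shaped_coboundary : exists f : V -> gT, forall x, B x ->
  exists2 e : R, 0 < e & forall y, B y -> `|y - x| < e -> (f x * tau x y)%g = f y.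
Proof.
pose lim x g := exists n0, forall n, (n0 <= n)%N -> hol x (2 ^ n) (2 ^ n) = g.
have large (x : V) (e : R) : 0 < e -> exists n0, forall n, (n0 <= n)%N -> `|x| < (2 ^ n)%:R * e.
  move=> e0; exists (Num.truncn (`|x| / e)).+1 => n n0n; rewrite -ltr_pdivrMr //.
  apply: lt_le_trans (truncnS_gt _) _; rewrite ler_nat (leq_trans n0n) //.
  by apply: ltnW; exact: ltn_expl.
have ex_lim x : exists g, B x -> lim x g.
  have [Bx|//] := pselect (B x); last by exists 1%g.
  have [e e0 He] := lebesgue_number Bx; have [n0 Hn0] := large x e e0.
  exists (hol x (2 ^ n0) (2 ^ n0)) => _; exists n0 => n.
  move=> /subnK <-; elim: (n - n0)%N => // k <-.
  rewrite addSn expnS mul2n; apply: (hol_double Bx He); rewrite ?expn_gt0 //.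
  by apply: Hn0; exact: leq_addl.
have [f Hf] := choice ex_lim; exists f => x Bx.
have [e e0 He] := lebesgue_number Bx; have e2 : 0 < e / 2 by lra.
exists (e / 2) => // y By xy.
have [n1 H1] := Hf _ Bx; have [n2 H2] := Hf _ By.
have [n3 H3] := large x _ e2; have [n4 H4] := large y _ e2.
pose n := (n1 + n2 + n3 + n4)%N.
rewrite -(H1 n) -1?(H2 n); [|rewrite /n; lia..].
apply: (hol_compat Bx By He); rewrite ?expn_gt0 //; [apply: H3|apply: H4]; rewrite /n; lia.
Qed.

End StarShaped.

(** * The complement of the unknot *)

Lemma coord_le_norm (R : realType) (x : 'rV[R]_3) j : `|x 0 j| <= `|x|.
Proof.
by rewrite [leRHS]/Num.norm /= mx_normrE; apply/bigmax_geP; right => /=; exists (0, j).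
Qed.

Section UnknotComplement.
Variables (R : realType) (gT : finGroupType).
Local Notation V := 'rV[R]_3.
Variable tau : V -> V -> gT.
Hypothesis ctau : local_cocycle (~` @unknot R) tau.

Definition rad2 (x : V) : R := x 0 0 ^+ 2 + x 0 1 ^+ 2.
Definition off_annulus : set V := [set x : V | x 0 2 != 0 \/ rad2 x < 1].
Definition annulus : set V := [set x : V | x 0 2 = 0 /\ 1 < rad2 x].

Lemma unknot_complP (x : V) : (~` @unknot R) x <-> off_annulus x \/ annulus x.
Proof.
rewrite /setC /unknot /off_annulus /annulus /=; split.
  have [z0|/eqP z0] := eqVneq (x 0 2) 0; last by left; left; apply/eqP.
  have [|r1] := ltP (rad2 x) 1; first by left; right.
  move=> H; right; split=> //; rewrite lt_neqAle r1 andbT eq_sym.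
  by apply/eqP => r; apply: H.
by case=> [[/eqP z0|r1]|[z0 r1]] [r z] //; move: r1; rewrite /rad2 r ltxx.
Qed.

Lemma rad2_near (x : V) d : 0 < d ->
  exists2 e, 0 < e & forall y, `|y - x| < e -> `|rad2 y - rad2 x| < d.
Proof.
move=> d0.
have c : {for x, continuous rad2}.
  have sq j : {for x, continuous (fun y : V => y 0 j ^+ 2)}.
    apply: (@continuous_comp V R R (fun y => y 0 j) (fun r => r ^+ 2)).
      exact: coord_continuous.
    exact: exprn_continuous.
  exact: cvgD (sq 0) (sq 1).
move/cvgrPdist_lt : c => /(_ d d0) /nbhs_normP [e /= e0 He].
by exists e => // y xy; rewrite distrC; apply: He; rewrite /= distrC.
Qed.

Lemma coord_near (x y : V) j e : `|y - x| < e -> `|y 0 j - x 0 j| < e.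
Proof.
by apply: le_lt_trans; have := coord_le_norm (y - x) j; rewrite !mxE.
Qed.

Lemma off_annulus_open (x : V) : off_annulus x ->
  exists2 e, 0 < e & forall y, `|y - x| < e -> off_annulus y.
Proof.
case=> [z0|r1].
  exists `|x 0 2|; first by rewrite normr_gt0.
  move=> y /(coord_near 2) xy; left; apply/eqP => y0; move: xy.
  by rewrite y0 sub0r normrN ltxx.
have [|e e0 He] := rad2_near x (d := 1 - rad2 x); first by lra.
exists e => // y /He; rewrite ltr_norml => /andP[_ yr]; right; lra.
Qed.

Lemma off_annulus_star (x : V) (t : R) : off_annulus x -> 0 <= t <= 1 -> off_annulus (t *: x).
Proof.
move=> Bx /andP[t0 t1]; have [->|tn0] := eqVneq t 0.
  by right; rewrite scale0r /rad2 !mxE; lra.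
case: Bx => [z0|r1]; [left|right].
  by rewrite mxE mulf_neq0.
rewrite /rad2 !mxE !exprMn -mulrDr -/(rad2 x).
apply: le_lt_trans r1; rewrite ler_piMl //; first by rewrite addr_ge0 ?sqr_ge0.
by rewrite expr_le1.
Qed.

(** On either open half of a small ball around [p], the map sending [x] to [f x * tau x p] is
    locally constant, because [f] is a primitive there and [tau] is a cocycle near [p]. The
    half-balls are convex, so each carries one constant. *)
Lemma annulus_jump (f : V -> gT) (p : V) :
  (forall x, off_annulus x -> exists2 e : R, 0 < e &
     forall y, off_annulus y -> `|y - x| < e -> (f x * tau x y)%g = f y) ->
  annulus p ->
  exists ul : gT * gT, exists2 e : R, 0 < e &
    forall x, `|x - p| < e ->
      (0 < x 0 2 -> (f x * tau x p)%g = ul.1) /\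
      (x 0 2 < 0 -> (f x * tau x p)%g = ul.2).
Proof.
move=> Hf Qp; have Xp : (~` @unknot R) p by apply/unknot_complP; right.
have [e e0 He] := ctau Xp.
have side (C : set V) :
    (forall x y (t : R), C x -> C y -> 0 <= t <= 1 -> C (x + t *: (y - x))) ->
    (forall x, C x -> off_annulus x) ->
  exists u, forall x, `|x - p| < e -> C x -> (f x * tau x p)%g = u.
  move=> cvx CB.
  have [[x0 [x0p Cx0]]|none] := pselect (exists x, `|x - p| < e /\ C x); last first.
    by exists 1%g => x xp Cx; case: none; exists x.
  exists (f x0 * tau x0 p)%g => x xp Cx.
  pose C' := [set x | `|x - p| < e /\ C x].
  apply: (@convex_locally_related R V C'
    (fun x y => (f x * tau x p)%g = (f y * tau y p)%g)) => //.
  - move=> y z t [yp Cy] [zp Cz] It; split; last exact: cvx.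
    have -> : y + t *: (z - y) - p = (1 - t) *: (y - p) + t *: (z - p).
      by rewrite scalerBl scale1r !scalerBr; apply/rowP => j; rewrite !mxE; ring.
    move/andP : It => [t0 t1]; apply: le_lt_trans (ler_normD _ _) _.
    rewrite !normrZ !ger0_norm ?subr_ge0 //.
    have [->|tn1] := eqVneq t 1; first by rewrite subrr mul0r add0r mul1r.
    have t1' : 0 < 1 - t by rewrite subr_gt0 lt_neqAle tn1.
    have H1 : (1 - t) * `|y - p| < (1 - t) * e by rewrite ltr_pM2l.
    have H2 : t * `|z - p| <= t * e by rewrite ler_wpM2l // ltW.
    lra.
  - by move=> y z w -> ->.
  - move=> y [yp Cy]; have [d d0 Hd] := Hf _ (CB _ Cy); exists d => // z [zp Cz] yz.
    rewrite -(Hd z) //; last exact: CB.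
    rewrite -mulgA; congr (_ * _)%g; rewrite He ?subrr ?normr0 //;
      by apply/unknot_complP; left; exact: CB.
have [||u Hu] := side [set x : V | 0 < x 0 2].
- move=> x y t /= x0 y0 /andP[t0 t1]; rewrite !mxE.
  have [->|tn0] := eqVneq t 0; first by rewrite mul0r addr0.
  have t0' : 0 < t by rewrite lt_def tn0.
  have := mulr_gt0 t0' y0; have : 0 <= (1 - t) * x 0 2 by apply: mulr_ge0; lra.
  lra.
- by move=> x /= x0; left; rewrite gt_eqF.
have [||l Hl] := side [set x : V | x 0 2 < 0].
- move=> x y t /= x0 y0 /andP[t0 t1]; rewrite !mxE.
  have [->|tn0] := eqVneq t 0; first by rewrite mul0r addr0.
  have t0' : 0 < t by rewrite lt_def tn0.
  have : 0 < t * - y 0 2 by apply: mulr_gt0; lra.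
  have : 0 <= (1 - t) * - x 0 2 by apply: mulr_ge0; lra.
  lra.
- by move=> x /= x0; left; rewrite lt_eqF.
by exists (u, l); exists e => // x xp; split=> ?; [exact: Hu|exact: Hl].
Qed.

(** Connectedness of the annulus by a chain of convex pieces, namely tangent half-planes. Every
    point is linked to (2, 0); a point on the first axis is moved off it beforehand. *)
Lemma annulus_related (E : V -> V -> Prop) :
  (forall x, E x x) ->
  (forall x y, E x y -> E y x) -> (forall x y z, E x y -> E y z -> E x z) ->
  (forall x, annulus x -> exists2 e : R, 0 < e &
     forall y, annulus y -> `|y - x| < e -> E x y) ->
  forall x y, annulus x -> annulus y -> E x y.
Proof.
move=> Erefl Esym Etrans locE.
(* [H p] is the half-plane tangent at [p] to the circle through [p]. *)
pose H p := [set x : V | x 0 2 = 0 /\ rad2 p <= p 0 0 * x 0 0 + p 0 1 * x 0 1].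
have HQ p : annulus p -> H p `<=` annulus.
  move=> [p2 p1] x [x2 px]; split=> //; apply: (lt_le_trans p1).
  have p0 : 0 < rad2 p by lra.
  rewrite -(ler_pM2l p0); apply: le_trans (_ : (p 0 0 * x 0 0 + p 0 1 * x 0 1) ^+ 2 <= _).
    by rewrite -expr2 ler_sqr // ?nnegrE; lra.
  (* Cauchy-Schwarz in the plane, by Lagrange's identity. *)
  rewrite -subr_ge0 (_ : _ - _ = (p 0 0 * x 0 1 - p 0 1 * x 0 0) ^+ 2) ?sqr_ge0 //.
  by rewrite /rad2; ring.
have EH p x y : annulus p -> H p x -> H p y -> E x y.
  move=> Qp; apply: convex_locally_related => //.
    move=> {}x {}y t [x2 px] [y2 py] /andP[t0 t1]; split.
      by rewrite !mxE x2 y2; ring.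
    rewrite !mxE.
    have : 0 <= (1 - t) * (p 0 0 * x 0 0 + p 0 1 * x 0 1 - rad2 p) by apply: mulr_ge0; lra.
    have : 0 <= t * (p 0 0 * y 0 0 + p 0 1 * y 0 1 - rad2 p) by apply: mulr_ge0; lra.
    lra.
  move=> {}x /(HQ _ Qp) Qx; have [e e0 He] := locE _ Qx; exists e => // {}y.
  by move=> /(HQ _ Qp); exact: He.
pose pt (a b : R) : V := \row_j (if j == 0 then a else if j == 1 then b else 0).
have [pt0 pt1 pt2] : [/\ forall a b, pt a b 0 0 = a, forall a b, pt a b 0 1 = b
    & forall a b, pt a b 0 2 = 0] by split=> a b; rewrite mxE.
have Hp p : annulus p -> H p p by move=> [p2 p1]; split=> //; rewrite /rad2 !expr2.
have Q2 : annulus (pt 2 0) by split; rewrite ?pt2 // /rad2 pt0 pt1; lra.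
(* The point [pt 2 b] is where the boundary line of [H p] meets that of [H (pt 2 0)]. *)
have base p : annulus p -> p 0 1 != 0 -> E p (pt 2 0).
  move=> Qp p1; pose b := (rad2 p - 2 * p 0 0) / p 0 1.
  apply: (Etrans _ (pt 2 b)).
    apply: (EH p) => //; first exact: Hp.
    by split; rewrite ?pt2 // pt0 pt1 /b mulrC [_ * (_ / _)]mulrC divfK //; lra.
  apply: (EH (pt 2 0) _ _ Q2 _ (Hp _ Q2)).
  by split; rewrite ?pt2 // /rad2 !pt0 !pt1; lra.
suff base' p : annulus p -> E p (pt 2 0).
  by move=> x y /base' Ex /base' Ey; apply: Etrans Ex (Esym _ _ Ey).
move=> Qp; have [p1|] := eqVneq (p 0 1) 0; last exact: base.
apply: (Etrans _ (pt (p 0 0) 1)).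
  apply: (EH p) => //; first exact: Hp.
  by split; rewrite ?pt2 // pt0 pt1 /rad2 p1; lra.
apply: base; last by rewrite pt1 oner_neq0.
case: Qp => _; rewrite /annulus /= /rad2 pt2 pt0 pt1 p1 => Qp; split=> //; lra.
Qed.

(** The section is the primitive off the annulus and its upper limit value [ul.1] on the annulus.
    Crossing to the upper side then causes no error, and crossing to the lower side causes the jump,
    which is constant along the annulus. *)
Lemma unknot_section : exists (c : gT) (f : V -> gT), forall x, ~ unknot x ->
  exists2 e : R, 0 < e & forall y, ~ unknot y -> `|y - x| < e ->
    (f x * tau x y * (f y)^-1)%g \in <[c]>%g.
Proof.
have cB : local_cocycle off_annulus tau.
  by apply: local_cocycleS ctau => x Bx; apply/unknot_complP; left.
have [f Hf] := star_shaped_coboundary off_annulus_star cB.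
have jumps p : exists ul : gT * gT, annulus p -> exists2 e : R, 0 < e &
    forall x, `|x - p| < e ->
      (0 < x 0 2 -> (f x * tau x p)%g = ul.1) /\
      (x 0 2 < 0 -> (f x * tau x p)%g = ul.2).
  have [Qp|nQp] := pselect (annulus p); last by exists (1, 1)%g.
  by have [ul Hul] := annulus_jump Hf Qp; exists ul.
have [ul Hul] := choice jumps.
(* Both one-sided values are compared at auxiliary points at height [r] above and below [q], with
   [r] small enough for them to lie in the balls chosen at [p] and at [q]. *)
have trans p : annulus p -> exists2 e : R, 0 < e & forall q, annulus q -> `|q - p| < e ->
    ul q = ((ul p).1 * tau p q, (ul p).2 * tau p q)%g.
  move=> Qp; have Xp : (~` @unknot R) p by apply/unknot_complP; right.
  have [e e0 He] := ctau Xp; have [d d0 Hd] := Hul p Qp.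
  exists (Num.min e d); first by rewrite lt_min e0.
  move=> q Qq; rewrite lt_min => /andP[qe qd].
  have Xq : (~` @unknot R) q by apply/unknot_complP; right.
  have [e' e'0 He'] := Hul q Qq.
  pose r := Num.min e' (Num.min (e - `|q - p|) (d - `|q - p|)) / 2.
  have r0 : 0 < r by rewrite divr_gt0 // !lt_min e'0 !subr_gt0 qe qd.
  have [r1 r2 r3] : [/\ r < e', r < e - `|q - p| & r < d - `|q - p|].
    have m1 : r * 2 <= e' by rewrite divfK ?pnatr_eq0 // ge_min lexx.
    have m2 : r * 2 <= e - `|q - p| by rewrite divfK ?pnatr_eq0 // !ge_min lexx orbT.
    have m3 : r * 2 <= d - `|q - p| by rewrite divfK ?pnatr_eq0 // !ge_min lexx !orbT.
    by split; lra.
  have test (s : R) : `|s| <= 1 -> exists x : V, [/\ x 0 2 = s * r, `|x - q| < e',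
      `|x - p| < e & `|x - p| < d].
    move=> s1; pose x : V := q + (s * r) *: delta_mx 0 2.
    have xq : `|x - q| <= r.
      rewrite /x addrAC subrr add0r normrZ normrM (gtr0_norm r0).
      have n1 : `|delta_mx 0 2 : V| <= 1.
        rewrite [leLHS]/Num.norm /= mx_normrE; apply/bigmax_leP; split=> // -[i j] _ /=.
        by rewrite mxE; case: (_ && _); rewrite ?normr1 ?normr0.
      rewrite -[leRHS]mul1r -[leRHS]mulr1; apply: ler_pM => //.
      + by rewrite mulr_ge0 // ltW.
      + by rewrite ler_pM2r.
    have xp : `|x - p| <= r + `|q - p|.
      have -> : x - p = (x - q) + (q - p) by rewrite addrA subrK.
      by apply: le_trans (ler_normD _ _) _; rewrite lerD2r.
    exists x; split; try lra.
    by case: Qq => q2 _; rewrite !mxE q2 add0r mulr1.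
  have Xoff (x : V) : x 0 2 != 0 -> (~` @unknot R) x by move=> ?; apply/unknot_complP; left; left.
  have ee : `|p - p| < e by rewrite subrr normr0.
  rewrite [ul q]surjective_pairing; congr (_, _).
    have [|x [x2 xq xe xd]] := test 1; first by rewrite normr1.
    have x0 : 0 < x 0 2 by rewrite x2 mul1r.
    rewrite -((He' x xq).1 x0) -((Hd x xd).1 x0) -mulgA.
    by rewrite (He x p q) //; apply: Xoff; rewrite gt_eqF.
  have [|x [x2 xq xe xd]] := test (-1); first by rewrite normrN normr1.
  have x0 : x 0 2 < 0 by rewrite x2 mulN1r oppr_lt0.
  rewrite -((He' x xq).2 x0) -((Hd x xd).2 x0) -mulgA.
  by rewrite (He x p q) //; apply: Xoff; rewrite lt_eqF.
(* The common right factor [tau p q] cancels in this quotient, so it is locally constant on the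
   annulus. *)
pose jump p := ((ul p).1 * (ul p).2^-1)%g.
have jumpE : forall p q, annulus p -> annulus q -> jump p = jump q.
  apply: annulus_related => //; first by move=> x y z -> ->.
  move=> p Qp; have [e e0 He] := trans p Qp; exists e => // q Qq pq.
  by rewrite /jump (He q Qq pq) /= invMg mulgA mulgK.
have [c Hc] : exists c, forall p, annulus p -> jump p = c.
  have [[p Qp]|none] := pselect (exists p, annulus p); last first.
    by exists 1%g => p Qp; case: none; exists p.
  by exists (jump p) => q Qq; exact: jumpE.
exists c, (fun x => if pselect (annulus x) then (ul x).1 else f x) => x Xx.
have one : 1%g \in <[c]>%g by exact: group1.
have notQ y : off_annulus y -> ~ annulus y.
  by case=> [/eqP y2|y1] [y2' y1'] //; lra.
case: pselect => [Qx|nQx]; last first.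
  have Bx : off_annulus x by case/unknot_complP : Xx.
  have [e e0 He] := Hf x Bx; have [d d0 Hd] := off_annulus_open Bx.
  exists (Num.min e d); first by rewrite lt_min e0.
  move=> y Xy; rewrite lt_min => /andP[ye yd].
  by case: pselect => [/notQ []|nQy]; [exact: Hd|rewrite He ?mulgV //; exact: Hd].
have [e e0 He] := ctau Xx; have [d d0 Hd] := Hul x Qx.
have [e' e'0 He'] := trans x Qx.
have [|b b0 Hb] := rad2_near x (d := rad2 x - 1); first by case: Qx => _; lra.
exists (Num.min (Num.min e d) (Num.min e' b)); first by rewrite !lt_min e0 d0 e'0.
move=> y Xy; rewrite !lt_min => /andP[/andP[ye yd] /andP[ye' yb]].
have xe : `|x - x| < e by rewrite subrr normr0.
have inv : (tau y x * tau x y)%g = 1%g.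
  have yyy := He y y y Xy Xy Xy ye ye ye.
  rewrite (He y x y) //; apply: (mulgI (tau y y)); by rewrite mulg1.
case: pselect => [Qy|nQy].
  by rewrite (He' y) //= mulgV.
have y2 : y 0 2 != 0.
  apply/eqP => y2; apply: nQy; split=> //.
  by have := Hb y yb; rewrite ltr_norml => /andP[? _]; lra.
have [y0|y0|y0] := ltgtP (y 0 2) 0; last by rewrite y0 eqxx in y2.
- rewrite (_ : _ * _ * _ = jump x)%g; first by rewrite Hc // cycle_id.
  rewrite /=.
  rewrite /jump -((Hd y yd).2 y0) invMg -!mulgA; congr (_ * _)%g.
  congr (_ * _)%g; by apply/eqP; rewrite eq_sym eq_invg_mul inv.
- rewrite -((Hd y yd).1 y0) -[(f y * _ * _)%g]mulgA inv mulg1 mulgV //.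
Qed.

End UnknotComplement.

(** * Cocycles from power diagrams *)

(** The end map [h] of the isotopy matches the two complements; [tau] is transported by its inverse
    [g], and the resulting section is pulled back along [h]. *)
Lemma isotopic_unknot_section (R : realType) (gT : finGroupType)
    (K : set 'rV[R]_3) (tau : 'rV[R]_3 -> 'rV[R]_3 -> gT) :
  ambient_isotopic K (@unknot R) -> local_cocycle (~` K) tau ->
  exists (c : gT) (f : 'rV[R]_3 -> gT), forall x, ~ K x ->
  exists2 e : R, 0 < e & forall y, ~ K y -> `|y - x| < e ->
    (f x * tau x y * (f y)^-1)%g \in <[c]>%g.
Proof.
case=> H [_ homH _]; set h := H 1 => hK ctau.
have [ch [g [cg hg gh]]] : homeomorphism h by apply: homH; rewrite ler01 lexx.
have KU x : K x <-> unknot (h x).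
  rewrite -hK; split=> [Kx|[y Ky]]; first by exists x.
  by move=> /(can_inj hg) <-.
have near_eps (k : 'rV[R]_3 -> 'rV[R]_3) x e : continuous k -> 0 < e ->
    exists2 d, 0 < d & forall y, `|y - x| < d -> `|k y - k x| < e.
  move=> ck e0; have /cvgrPdist_lt/(_ e e0)/nbhs_normP[d /= d0 Hd] := ck x.
  by exists d => // y yx; rewrite distrC; apply: Hd; rewrite /= distrC.
have [|c [f Hf]] := @unknot_section R gT (fun x y => tau (g x) (g y)).
  have KUg y : ~ unknot y -> ~ K (g y) by move=> Uy /KU; rewrite gh.
  move=> x Ux; have [e e0 He] := ctau _ (KUg _ Ux).
  have [d d0 Hd] := near_eps g x e cg e0.
  by exists d => // a b b' Ua Ub Ub' /Hd ? /Hd ? /Hd ?; apply: He => //; exact: KUg.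
exists c, (f \o h) => x Kx.
have [|e e0 He] := Hf (h x); first by move/KU.
have [d d0 Hd] := near_eps h x e ch e0.
exists d => // y Ky /Hd /He; rewrite !hg; apply.
by move/KU.
Qed.

(** * Integral affine forms and power diagrams *)

Definition affine := (int * int * int * int)%type.
Definition zpoint := (int * int * int)%type.

(* Points are measured in units of 1/8, which makes the barycenters of
   pyramids integral. *)
Definition value (R : realType) (a : affine) (x : 'rV[R]_3) : R :=
  a.1.1.1%:~R * (8 * x 0 0) + a.1.1.2%:~R * (8 * x 0 1) +
  a.1.2%:~R * (8 * x 0 2) + a.2%:~R.

Definition combine (k : int) (a b : affine) : affine :=
  (k * a.1.1.1 + b.1.1.1, k * a.1.1.2 + b.1.1.2, k * a.1.2 + b.1.2, k * a.2 + b.2).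

Lemma value_combine (R : realType) k a b (x : 'rV[R]_3) :
  value (combine k a b) x = k%:~R * value a x + value b x.
Proof. by rewrite /value /combine /= !rmorphD !rmorphM /=; ring. Qed.

Lemma value_line (R : realType) a (x y : 'rV[R]_3) (t : R) :
  value a ((1 - t) *: x + t *: y) = (1 - t) * value a x + t * value a y.
Proof. by rewrite /value !mxE; ring. Qed.

Lemma value_continuous (R : realType) a : continuous (@value R a).
Proof.
move=> x; have c (k : int) j : {for x, continuous (fun y : 'rV[R]_3 => k%:~R * (8 * y 0 j))}.
  apply: continuousM; first exact: cst_continuous.
  by apply: continuousM; [exact: cst_continuous|exact: coord_continuous].
exact: cvgD (cvgD (cvgD (c a.1.1.1 0) (c a.1.1.2 1)) (c a.1.2 2)) (cvg_cst _).
Qed.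

Section PowerDiagram.
Variables (R : realType) (sites : seq affine) (gT : finGroupType).
Variables (g : nat -> nat -> gT) (K : set 'rV[R]_3).
Local Notation V := 'rV[R]_3.
Local Notation fval s x := (value (nth (0, 0, 0, 0) sites s) x).

(** For a form [v . X - 2 |v|^2 + w] with [X = 8 x], a maximal value means a minimal power
    [|x - v/2|^2 - w/8], so these are the cells of a power diagram with sites [v/2]. *)
Definition in_cell s (x : V) :=
  (s < size sites)%N /\ forall t, (t < size sites)%N -> fval t x <= fval s x.

Definition in_open_cell s (x : V) := (s < size sites)%N /\
  forall t, (t < size sites)%N -> t <> s -> fval t x < fval s x.

Hypothesis sites_gt0 : (0 < size sites)%N.

Hypothesis g_cocycle : forall u v w x, in_cell u x -> in_cell v x -> in_cell w x ->
  ~ K x -> (g u v * g v w)%g = g u w.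

Lemma label_exists : exists label : V -> nat, forall x, in_cell (label x) x.
Proof.
suff ex x : exists s, in_cell s x by have [l Hl] := choice ex; exists l.
pose i0 := Ordinal sites_gt0.
have [i _ Hi] := @Order.TotalTheory.arg_maxP _ R _ i0 xpredT
  (fun i : 'I_(size sites) => fval i x) erefl.
by exists i; split=> // t tN; exact: (Hi (Ordinal tN)).
Qed.

(** The finitely many strict inequalities between forms at [x] persist nearby. *)
Lemma in_cell_near x : exists2 e : R, 0 < e &
  forall y s, `|y - x| < e -> in_cell s y -> in_cell s x.
Proof.
have : \forall y \near x, forall p : 'I_(size sites) * 'I_(size sites),
    fval p.1 x < fval p.2 x -> fval p.1 y < fval p.2 y.
  apply: (@filter_forall V ('I_(size sites) * 'I_(size sites))%type
    (fun p y => fval p.1 x < fval p.2 x -> fval p.1 y < fval p.2 y) (nbhs x) _) => -[s t] /=.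
  have [st|st] := boolP (fval s x < fval t x); last first.
    by apply: filterE => y.
  have : (fun y => fval t y - fval s y) y @[y --> x] --> fval t x - fval s x.
    exact: cvgB (@value_continuous R _ x) (@value_continuous R _ x).
  move/cvgr_gt => /(_ 0); rewrite subr_gt0 => /(_ st).
  by apply: filterS => y; rewrite subr_gt0.
move/nbhs_normP => [e /= e0 He]; exists e => // y s yx [sN maxs].
split=> // t tN; rewrite leNgt; apply/negP => st.
have := He y _ (Ordinal sN, Ordinal tN) st; rewrite /= distrC => /(_ yx).
by rewrite ltNge maxs.
Qed.

Variable label : V -> nat.
Hypothesis labelP : forall x, in_cell (label x) x.

(** All labels near [x] are cells through [x], so [g_cocycle] applies at [x] itself, however [label]
    chooses on common faces. *)
Lemma label_cocycle : local_cocycle (~` K) (fun x y => g (label x) (label y)).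
Proof.
move=> x Kx; have [e e0 He] := in_cell_near x; exists e => // a b c _ _ _ ax bx cx.
by apply: (g_cocycle (x := x)) => //; apply: He (labelP _).
Qed.

Lemma label_open_cell s x : in_open_cell s x -> label x = s.
Proof.
move=> [sN Hs]; have [lN Hl] := labelP x; apply/eqP/negPn/negP => /eqP ls.
by have := Hs _ lN ls; rewrite ltNge Hl.
Qed.

Variables (c : gT) (f : V -> gT).
Hypothesis f_section : forall x, ~ K x ->
  exists2 e : R, 0 < e & forall y, ~ K y -> `|y - x| < e ->
    (f x * g (label x) (label y) * (f y)^-1)%g \in <[c]>%g.

(** The label is constant on an open cell, so there [f] varies locally only within a right coset of
    [<[c]>]; convexity makes this global. *)
Lemma open_cell_constant s x y : g s s = 1%g ->
  (forall z, in_open_cell s z -> ~ K z) ->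
  in_open_cell s x -> in_open_cell s y -> (f x * (f y)^-1)%g \in <[c]>%g.
Proof.
move=> gss sK; apply: (@convex_locally_related R V (in_open_cell s)
  (fun x y => (f x * (f y)^-1)%g \in <[c]>%g)).
- move=> {}x {}y t [sN Hx] [_ Hy] /andP[t0 t1]; split=> // r rN rs.
  have -> : x + t *: (y - x) = (1 - t) *: x + t *: y.
    by apply/rowP => j; rewrite !mxE; ring.
  rewrite !value_line; have := Hx r rN rs; have := Hy r rN rs => H1 H2.
  have [->|t1'] := eqVneq t 1; first by rewrite subrr !mul0r !add0r !mul1r.
  have : (1 - t) * fval r x < (1 - t) * fval s x.
    by rewrite ltr_pM2l // subr_gt0 lt_neqAle t1'.
  have : t * fval r y <= t * fval s y by rewrite ler_wpM2l // ltW.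
  by lra.
- by move=> z; rewrite mulgV group1.
- by move=> z w /groupVr; rewrite invMg invgK.
- by move=> z w r zw wr; have := groupM zw wr; rewrite mulgA mulgKV.
- move=> z Cz; have [e e0 He] := f_section (sK z Cz); exists e => // w Cw wz.
  have := He w (sK w Cw) wz.
  by rewrite (label_open_cell Cz) (label_open_cell Cw) gss mulg1.
Qed.

(* [p] lies in the relative interior of the face between the cells of [u] and [v]. *)
Lemma crossing_transition u v x y p :
  g u u = 1%g -> g v v = 1%g -> (g v u * g u v)%g = 1%g ->
  (forall z, in_open_cell u z -> ~ K z) ->
  (forall z, in_open_cell v z -> ~ K z) ->
  in_open_cell u x -> in_open_cell v y -> ~ K p ->
  in_cell u p -> in_cell v p ->
  (forall t, in_cell t p -> t = u \/ t = v) ->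
  (f x * g u v * (f y)^-1)%g \in <[c]>%g.
Proof.
move=> guu gvv gvu uK vK Cx Cy Kp up vp uvp.
have [e e0 He] := f_section Kp.
(* The weak inequalities at [p] and the strict ones at [q] combine to strict ones after any positive
   step from [p] towards [q]. *)
have approach s q : in_cell s p -> in_open_cell s q ->
    exists2 z, in_open_cell s z & `|z - p| < e.
  move=> [sN sp] [_ sq].
  have n0 : 0 < 1 + `|q - p| by apply: ltr_pwDl.
  pose t := Num.min 1 (e / 2 / (1 + `|q - p|)).
  have t0 : 0 < t by rewrite lt_min ltr01 !divr_gt0.
  have t1 : t <= 1 by rewrite ge_min lexx.
  have te : t <= e / 2 / (1 + `|q - p|) by rewrite ge_min lexx orbT.
  exists ((1 - t) *: p + t *: q).
    split=> // r rN rs; rewrite !value_line.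
    have : t * fval r q < t * fval s q by rewrite ltr_pM2l //; exact: sq.
    have : (1 - t) * fval r p <= (1 - t) * fval s p.
      by rewrite ler_wpM2l ?subr_ge0 //; exact: sp.
    lra.
  have -> : (1 - t) *: p + t *: q - p = t *: (q - p).
    by apply/rowP => j; rewrite !mxE; ring.
  rewrite normrZ gtr0_norm //.
  move: te; rewrite ler_pdivlMr // mulrDr mulr1 => te; lra.
have [z Cz zp] := approach _ _ up Cx; have [w Cw wp] := approach _ _ vp Cy.
have Hz := He z (uK _ Cz) zp; have Hw := He w (vK _ Cw) wp.
rewrite (label_open_cell Cz) in Hz; rewrite (label_open_cell Cw) in Hw.
have Gxz := open_cell_constant guu uK Cx Cz.
have Gwy := open_cell_constant gvv vK Cw Cy.
have Gzw : (f z * g u v * (f w)^-1)%g \in <[c]>%g.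
  (* The comparison passes through [p], whose label is [u] or [v]; the normalizations of [g] give
     [g u v] in both cases. *)
  have -> : (f z * g u v * (f w)^-1 = (f p * g (label p) u * (f z)^-1)^-1 *
      (f p * g (label p) v * (f w)^-1))%g.
    rewrite !invMg invgK !mulgA mulgKV; congr (_ * _)%g; rewrite -mulgA; congr (_ * _)%g.
    case: (uvp _ (labelP p)) => ->; first by rewrite guu invg1 mul1g.
    by rewrite gvv mulg1; apply/esym/eqP; rewrite eq_invg_mul gvu.
  by rewrite groupM // groupV.
have := groupM (groupM Gxz Gzw) Gwy.
by rewrite !mulgA !(mulgKV).
Qed.

End PowerDiagram.

(** * The gallery *)

(* Vertices of colors A, B, C, D, in units of 1/2. *)
Definition gallery_pyramids : seq (zpoint * zpoint * zpoint * zpoint) := [::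
  ((0, 0, 0), (-2, 0, 0), (-1, -1, 0), (-1, -1, 1));
  ((0, 0, 0), (-2, 0, 0), (-1, 0, 1), (-1, -1, 1));
  ((0, 0, 0), (0, 0, 2), (-1, 0, 1), (-1, -1, 1));
  ((0, 0, 0), (0, 0, 2), (-1, 0, 1), (-1, 1, 1));
  ((-2, 0, 2), (0, 0, 2), (-1, 0, 1), (-1, 1, 1));
  ((-2, 0, 2), (0, 0, 2), (-1, 1, 2), (-1, 1, 1));
  ((-2, 0, 2), (-2, 2, 2), (-1, 1, 2), (-1, 1, 1));
  ((-2, 0, 2), (-2, 2, 2), (-2, 1, 1), (-1, 1, 1));
  ((-2, 0, 2), (-2, 0, 0), (-2, 1, 1), (-1, 1, 1));
  ((-2, 2, 0), (-2, 0, 0), (-2, 1, 1), (-1, 1, 1));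
  ((-2, 2, 0), (-2, 0, 0), (-1, 1, 0), (-1, 1, 1));
  ((-2, 2, 0), (-2, 0, 0), (-1, 1, 0), (-1, 1, -1));
  ((0, 0, 0), (-2, 0, 0), (-1, 1, 0), (-1, 1, -1));
  ((0, 0, 0), (-2, 0, 0), (-1, 0, -1), (-1, 1, -1));
  ((0, 0, 0), (0, 0, -2), (-1, 0, -1), (-1, 1, -1));
  ((0, 0, 0), (0, 0, -2), (-1, 0, -1), (-1, -1, -1));
  ((0, 0, 0), (0, 0, -2), (0, -1, -1), (-1, -1, -1));
  ((0, 0, 0), (0, -2, 0), (0, -1, -1), (-1, -1, -1));
  ((0, 0, 0), (0, -2, 0), (-1, -1, 0), (-1, -1, -1));
  ((-2, -2, 0), (0, -2, 0), (-1, -1, 0), (-1, -1, -1));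
  ((-2, -2, 0), (-2, 0, 0), (-1, -1, 0), (-1, -1, -1));
  ((-2, -2, 0), (-2, 0, 0), (-1, -1, 0), (-1, -1, 1));
  ((-2, -2, 0), (-2, 0, 0), (-2, -1, 1), (-1, -1, 1));
  ((-2, 0, 2), (-2, 0, 0), (-2, -1, 1), (-1, -1, 1));
  ((-2, 0, 2), (-2, 0, 0), (-1, 0, 1), (-1, -1, 1));
  ((-2, 0, 2), (-2, 0, 0), (-1, 0, 1), (-1, 1, 1));
  ((0, 0, 0), (-2, 0, 0), (-1, 0, 1), (-1, 1, 1));
  ((0, 0, 0), (-2, 0, 0), (-1, 1, 0), (-1, 1, 1));
  ((0, 0, 0), (0, 2, 0), (-1, 1, 0), (-1, 1, 1));
  ((0, 0, 0), (0, 2, 0), (-1, 1, 0), (-1, 1, -1));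
  ((0, 0, 0), (0, 2, 0), (0, 1, -1), (-1, 1, -1));
  ((0, 2, -2), (0, 2, 0), (0, 1, -1), (-1, 1, -1));
  ((0, 2, -2), (0, 0, -2), (0, 1, -1), (-1, 1, -1));
  ((0, 2, -2), (0, 0, -2), (-1, 1, -2), (-1, 1, -1));
  ((-2, 0, -2), (0, 0, -2), (-1, 1, -2), (-1, 1, -1));
  ((-2, 0, -2), (0, 0, -2), (-1, 0, -1), (-1, 1, -1));
  ((-2, 0, -2), (0, 0, -2), (-1, 0, -1), (-1, -1, -1));
  ((-2, 0, -2), (-2, 0, 0), (-1, 0, -1), (-1, -1, -1));
  ((0, 0, 0), (-2, 0, 0), (-1, 0, -1), (-1, -1, -1));
  ((0, 0, 0), (-2, 0, 0), (-1, -1, 0), (-1, -1, -1))]%Z.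

Definition gallery_word : seq color := [::
  colC; colB; colD; colA; colC; colB; colC; colB; colA; colC; colD; colA;
  colC; colB; colD; colC; colB; colC; colA; colB; colD; colC; colA; colC;
  colD; colA; colC; colB; colD; colC; colA; colB; colC; colA; colC; colD;
  colB; colA; colC; colD].

(* The vertex v (in units of 1/2) of color s gives the form v . X - 2 |v|^2 + w_s
   in X = 8 x, where w_A = w_B = 2, w_C = 0, w_D = 1; with these weights the four
   forms of a pyramid agree at its barycenter. *)
Definition sites : seq affine := [::
  (-2, -2, 0, -14); (-2, -1, 1, -12); (-2, 0, -2, -14); (-2, 0, 0, -6);
  (-2, 0, 2, -14); (-2, 1, 1, -12); (-2, 2, 0, -14); (-2, 2, 2, -22);
  (-1, -1, -1, -5); (-1, -1, 0, -4); (-1, -1, 1, -5); (-1, 0, -1, -4);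
  (-1, 0, 1, -4); (-1, 1, -2, -12); (-1, 1, -1, -5); (-1, 1, 0, -4);
  (-1, 1, 1, -5); (-1, 1, 2, -12); (0, -2, 0, -6); (0, -1, -1, -4);
  (0, 0, -2, -6); (0, 0, 0, 2); (0, 0, 2, -6); (0, 1, -1, -4);
  (0, 2, -2, -14); (0, 2, 0, -6)]%Z.

(* Entry (u, v) is the code (see [code_perm]) of the transition from cell u to
   cell v; it is junk when the two cells are disjoint. *)
Definition transition_table : seq (seq nat) := [::
  [:: 0; 0; 0; 0; 0; 0; 0; 0; 0; 0; 0; 0; 0; 0; 0; 0; 0; 0; 0; 0; 0; 0; 0; 0; 0; 0];
  [:: 0; 0; 0; 0; 0; 0; 0; 0; 0; 0; 0; 0; 0; 0; 0; 0; 0; 0; 0; 0; 0; 0; 0; 0; 0; 0];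
  [:: 0; 0; 0; 0; 0; 0; 0; 0; 0; 0; 0; 0; 0; 0; 0; 0; 0; 0; 0; 0; 0; 0; 0; 0; 0; 0];
  [:: 0; 0; 0; 0; 0; 0; 0; 0; 0; 1; 1; 0; 1; 0; 0; 5; 5; 0; 0; 0; 0; 4; 0; 0; 0; 0];
  [:: 0; 0; 0; 0; 0; 0; 0; 0; 0; 0; 0; 0; 0; 0; 0; 0; 5; 0; 0; 0; 0; 0; 0; 0; 0; 0];
  [:: 0; 0; 0; 0; 0; 0; 0; 0; 0; 0; 0; 0; 0; 0; 0; 0; 0; 0; 0; 0; 0; 0; 0; 0; 0; 0];
  [:: 0; 0; 0; 0; 0; 0; 0; 0; 0; 0; 0; 0; 0; 0; 0; 0; 0; 0; 0; 0; 0; 0; 0; 0; 0; 0];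
  [:: 0; 0; 0; 0; 0; 0; 0; 0; 0; 0; 0; 0; 0; 0; 0; 0; 0; 0; 0; 0; 0; 0; 0; 0; 0; 0];
  [:: 0; 0; 0; 0; 0; 0; 0; 0; 0; 1; 0; 2; 0; 0; 0; 0; 0; 0; 0; 0; 0; 1; 0; 0; 0; 0];
  [:: 0; 0; 0; 1; 0; 0; 0; 0; 1; 0; 0; 0; 0; 0; 0; 0; 0; 0; 0; 0; 0; 0; 0; 0; 0; 0];
  [:: 0; 0; 0; 1; 0; 0; 0; 0; 0; 0; 0; 0; 0; 0; 0; 0; 0; 0; 0; 0; 0; 0; 0; 0; 0; 0];
  [:: 0; 0; 0; 0; 0; 0; 0; 0; 2; 0; 0; 0; 0; 0; 0; 0; 0; 0; 0; 0; 2; 4; 0; 0; 0; 0];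
  [:: 0; 0; 0; 1; 0; 0; 0; 0; 0; 0; 0; 0; 0; 0; 0; 0; 5; 0; 0; 0; 0; 5; 0; 0; 0; 0];
  [:: 0; 0; 0; 0; 0; 0; 0; 0; 0; 0; 0; 0; 0; 0; 0; 0; 0; 0; 0; 0; 0; 0; 0; 0; 0; 0];
  [:: 0; 0; 0; 0; 0; 0; 0; 0; 0; 0; 0; 0; 0; 0; 0; 0; 0; 0; 0; 0; 2; 2; 0; 2; 0; 0];
  [:: 0; 0; 0; 5; 0; 0; 0; 0; 0; 0; 0; 0; 0; 0; 0; 0; 0; 0; 0; 0; 0; 2; 0; 0; 0; 0];
  [:: 0; 0; 0; 5; 5; 0; 0; 0; 0; 0; 0; 0; 5; 0; 0; 0; 0; 0; 0; 0; 0; 0; 0; 0; 0; 0];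
  [:: 0; 0; 0; 0; 0; 0; 0; 0; 0; 0; 0; 0; 0; 0; 0; 0; 0; 0; 0; 0; 0; 0; 0; 0; 0; 0];
  [:: 0; 0; 0; 0; 0; 0; 0; 0; 0; 0; 0; 0; 0; 0; 0; 0; 0; 0; 0; 0; 0; 0; 0; 0; 0; 0];
  [:: 0; 0; 0; 0; 0; 0; 0; 0; 0; 0; 0; 0; 0; 0; 0; 0; 0; 0; 0; 0; 0; 0; 0; 0; 0; 0];
  [:: 0; 0; 0; 0; 0; 0; 0; 0; 0; 0; 0; 2; 0; 0; 2; 0; 0; 0; 0; 0; 0; 0; 0; 0; 0; 0];
  [:: 0; 0; 0; 3; 0; 0; 0; 0; 1; 0; 0; 3; 5; 0; 2; 2; 0; 0; 0; 0; 0; 0; 0; 0; 0; 0];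
  [:: 0; 0; 0; 0; 0; 0; 0; 0; 0; 0; 0; 0; 0; 0; 0; 0; 0; 0; 0; 0; 0; 0; 0; 0; 0; 0];
  [:: 0; 0; 0; 0; 0; 0; 0; 0; 0; 0; 0; 0; 0; 0; 2; 0; 0; 0; 0; 0; 0; 0; 0; 0; 0; 0];
  [:: 0; 0; 0; 0; 0; 0; 0; 0; 0; 0; 0; 0; 0; 0; 0; 0; 0; 0; 0; 0; 0; 0; 0; 0; 0; 0];
  [:: 0; 0; 0; 0; 0; 0; 0; 0; 0; 0; 0; 0; 0; 0; 0; 0; 0; 0; 0; 0; 0; 0; 0; 0; 0; 0]]%N.

(** The multiplication table of S_3, with elements 1, s, t, st, ts, sts coded in this order. *)
Definition code_table : seq (seq nat) := [::
  [:: 0; 1; 2; 3; 4; 5]; [:: 1; 0; 3; 2; 5; 4]; [:: 2; 4; 0; 5; 1; 3];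
  [:: 3; 5; 1; 4; 0; 2]; [:: 4; 2; 5; 0; 3; 1]; [:: 5; 3; 4; 1; 2; 0]]%N.

(* (u, v, ss, ks) witnesses that the cells u and v are disjoint: the combination
   of the forms [ss] with coefficients [ks] is a positive constant. *)
Definition disjointness_certificates : seq (nat * nat * seq nat * seq int) := [::
  (0, 11, [:: 0; 3; 8; 11], [:: -1; 1; 2; -2]%Z);
  (0, 12, [:: 0; 1; 9; 12], [:: -1; 1; 1; -1]%Z);
  (0, 14, [:: 0; 3; 8; 14], [:: -1; 1; 1; -1]%Z);
  (0, 15, [:: 0; 3; 9; 15], [:: -1; 1; 1; -1]%Z);
  (0, 16, [:: 0; 3; 10; 16], [:: -1; 1; 1; -1]%Z);
  (0, 21, [:: 0; 9; 21], [:: -1; 2; -1]%Z);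
  (1, 9, [:: 0; 1; 3; 9; 10], [:: 1; -2; 1; -2; 2]%Z);
  (1, 11, [:: 1; 3; 9; 11], [:: -1; 1; 1; -1]%Z);
  (1, 12, [:: 1; 3; 4; 10; 12], [:: -2; 1; 1; 2; -2]%Z);
  (1, 14, [:: 1; 3; 10; 14], [:: -2; 2; 1; -1]%Z);
  (1, 15, [:: 1; 3; 12; 15], [:: -1; 1; 1; -1]%Z);
  (1, 16, [:: 1; 5; 12; 16], [:: -1; 1; 2; -2]%Z);
  (1, 21, [:: 1; 9; 12; 21], [:: -1; 1; 1; -1]%Z);
  (2, 9, [:: 2; 3; 8; 9], [:: -1; 1; 2; -2]%Z);
  (2, 10, [:: 2; 3; 8; 10], [:: -1; 1; 1; -1]%Z);
  (2, 12, [:: 2; 3; 11; 12], [:: -1; 1; 1; -1]%Z);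
  (2, 15, [:: 2; 3; 14; 15], [:: -1; 1; 2; -2]%Z);
  (2, 16, [:: 2; 3; 14; 16], [:: -1; 1; 1; -1]%Z);
  (2, 21, [:: 2; 11; 21], [:: -1; 2; -1]%Z);
  (2, 23, [:: 2; 11; 13; 23], [:: -1; 1; 1; -1]%Z);
  (3, 7, [:: 3; 5; 7], [:: -1; 2; -1]%Z);
  (3, 13, [:: 2; 3; 13; 14], [:: 1; -1; -2; 2]%Z);
  (3, 17, [:: 3; 5; 12; 17], [:: -1; 1; 1; -1]%Z);
  (3, 18, [:: 3; 9; 18], [:: -1; 2; -1]%Z);
  (3, 19, [:: 3; 9; 11; 19], [:: -1; 1; 1; -1]%Z);
  (3, 20, [:: 3; 11; 20], [:: -1; 2; -1]%Z);
  (3, 22, [:: 3; 12; 22], [:: -1; 2; -1]%Z);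
  (3, 23, [:: 3; 11; 15; 23], [:: -1; 1; 1; -1]%Z);
  (3, 24, [:: 3; 14; 24], [:: -1; 2; -1]%Z);
  (3, 25, [:: 3; 15; 25], [:: -1; 2; -1]%Z);
  (4, 6, [:: 4; 5; 6], [:: -1; 2; -1]%Z);
  (4, 9, [:: 1; 4; 9; 12], [:: 1; -1; -1; 1]%Z);
  (4, 11, [:: 3; 4; 11; 12], [:: 1; -1; -1; 1]%Z);
  (4, 15, [:: 4; 5; 12; 15], [:: -1; 1; 1; -1]%Z);
  (4, 20, [:: 3; 4; 20; 21], [:: 1; -1; -1; 1]%Z);
  (4, 21, [:: 4; 12; 21], [:: -1; 2; -1]%Z);
  (4, 23, [:: 4; 12; 15; 23], [:: -1; 1; 1; -1]%Z);
  (4, 25, [:: 4; 16; 25], [:: -1; 2; -1]%Z);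
  (5, 9, [:: 3; 5; 9; 12], [:: 1; -1; -1; 1]%Z);
  (5, 10, [:: 1; 5; 10; 12], [:: 1; -1; -2; 2]%Z);
  (5, 11, [:: 3; 5; 11; 15], [:: 1; -1; -1; 1]%Z);
  (5, 12, [:: 3; 4; 5; 12; 16], [:: 1; 1; -2; -2; 2]%Z);
  (5, 14, [:: 3; 5; 6; 12; 14], [:: 1; -4; 3; 2; -2]%Z);
  (5, 15, [:: 3; 5; 6; 15; 16], [:: 1; -2; 1; -2; 2]%Z);
  (5, 21, [:: 5; 12; 15; 21], [:: -1; 1; 1; -1]%Z);
  (6, 9, [:: 3; 6; 9; 15], [:: 1; -1; -1; 1]%Z);
  (6, 10, [:: 3; 6; 10; 16], [:: 1; -1; -1; 1]%Z);
  (6, 11, [:: 3; 6; 11; 14], [:: 1; -1; -2; 2]%Z);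
  (6, 12, [:: 5; 6; 12; 15], [:: 1; -1; -1; 1]%Z);
  (6, 20, [:: 6; 14; 20], [:: -1; 2; -1]%Z);
  (6, 21, [:: 6; 15; 21], [:: -1; 2; -1]%Z);
  (6, 23, [:: 6; 14; 23; 25], [:: -1; 2; -2; 1]%Z);
  (7, 8, [:: 3; 7; 8; 16], [:: 1; -1; -1; 1]%Z);
  (7, 12, [:: 5; 7; 12; 17], [:: 1; -1; -1; 1]%Z);
  (7, 20, [:: 7; 15; 20], [:: -1; 2; -1]%Z);
  (7, 21, [:: 7; 16; 21], [:: -1; 2; -1]%Z);
  (7, 23, [:: 5; 7; 23; 25], [:: 1; -1; -1; 1]%Z);
  (8, 10, [:: 8; 9; 10], [:: -1; 2; -1]%Z);
  (8, 12, [:: 8; 9; 11; 12], [:: -2; 2; 1; -1]%Z);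
  (8, 13, [:: 2; 3; 8; 13; 20], [:: 1; 1; -2; -2; 2]%Z);
  (8, 14, [:: 8; 11; 14], [:: -1; 2; -1]%Z);
  (8, 15, [:: 8; 9; 11; 15], [:: -2; 1; 2; -1]%Z);
  (8, 16, [:: 3; 8; 16; 21], [:: 1; -1; -1; 1]%Z);
  (8, 17, [:: 8; 10; 15; 17], [:: -1; 1; 1; -1]%Z);
  (8, 22, [:: 8; 10; 21; 22], [:: -1; 1; 1; -1]%Z);
  (8, 23, [:: 8; 11; 19; 23], [:: -2; 2; 1; -1]%Z);
  (8, 24, [:: 8; 14; 20; 24], [:: -1; 1; 1; -1]%Z);
  (8, 25, [:: 8; 14; 21; 25], [:: -1; 1; 1; -1]%Z);
  (9, 11, [:: 3; 8; 9; 11; 21], [:: 1; 2; -2; -2; 1]%Z);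
  (9, 12, [:: 3; 9; 10; 12; 21], [:: 1; -2; 2; -2; 1]%Z);
  (9, 14, [:: 9; 11; 12; 14], [:: -2; 3; 1; -2]%Z);
  (9, 15, [:: 3; 9; 15; 21], [:: 1; -1; -1; 1]%Z);
  (9, 16, [:: 9; 11; 12; 16], [:: -2; 1; 3; -2]%Z);
  (9, 19, [:: 8; 9; 18; 19; 21], [:: 2; -2; 1; -2; 1]%Z);
  (9, 20, [:: 9; 11; 19; 20], [:: -1; 1; 1; -1]%Z);
  (10, 11, [:: 9; 10; 11; 12], [:: 2; -2; -1; 1]%Z);
  (10, 14, [:: 3; 10; 14; 21], [:: 1; -1; -1; 1]%Z);
  (10, 15, [:: 8; 10; 12; 15], [:: 1; -3; 4; -2]%Z);
  (10, 16, [:: 10; 12; 16], [:: -1; 2; -1]%Z);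
  (11, 12, [:: 3; 11; 12; 21], [:: 1; -1; -1; 1]%Z);
  (11, 13, [:: 2; 11; 13; 14; 20], [:: 1; -2; -2; 2; 1]%Z);
  (11, 15, [:: 3; 11; 14; 15; 21], [:: 1; -2; 2; -2; 1]%Z);
  (11, 16, [:: 9; 11; 15; 16], [:: 1; -2; 3; -2]%Z);
  (11, 18, [:: 9; 11; 18; 19], [:: 1; -1; -1; 1]%Z);
  (11, 19, [:: 8; 11; 19; 20; 21], [:: 2; -2; -2; 1; 1]%Z);
  (11, 22, [:: 11; 12; 21; 22], [:: -1; 1; 1; -1]%Z);
  (11, 23, [:: 11; 14; 20; 21; 23], [:: -2; 2; 1; 1; -2]%Z);
  (11, 24, [:: 11; 13; 23; 24], [:: -1; 1; 1; -1]%Z);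
  (11, 25, [:: 11; 15; 23; 25], [:: -1; 1; 1; -1]%Z);
  (12, 14, [:: 8; 12; 14; 15], [:: 1; -2; -3; 4]%Z);
  (12, 15, [:: 3; 12; 15; 16; 21], [:: 1; -2; -2; 2; 1]%Z);
  (12, 17, [:: 4; 12; 16; 17; 22], [:: 1; -2; 2; -2; 1]%Z);
  (12, 18, [:: 10; 12; 18; 21], [:: 2; -2; -1; 1]%Z);
  (12, 19, [:: 9; 12; 19; 21], [:: 1; -1; -1; 1]%Z);
  (12, 20, [:: 11; 12; 20; 21], [:: 1; -1; -1; 1]%Z);
  (12, 23, [:: 12; 15; 21; 23], [:: -1; 1; 1; -1]%Z);
  (12, 25, [:: 12; 16; 21; 25], [:: -2; 2; 1; -1]%Z);
  (13, 16, [:: 13; 14; 15; 16], [:: -1; 1; 1; -1]%Z);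
  (13, 21, [:: 11; 13; 21; 23], [:: 1; -1; -1; 1]%Z);
  (13, 23, [:: 13; 14; 20; 23; 24], [:: -2; 2; 1; -2; 1]%Z);
  (14, 16, [:: 14; 15; 16], [:: -1; 2; -1]%Z);
  (14, 18, [:: 8; 14; 18; 21], [:: 1; -1; -1; 1]%Z);
  (14, 19, [:: 11; 14; 19; 23], [:: 2; -2; -1; 1]%Z);
  (14, 22, [:: 14; 16; 21; 22], [:: -1; 1; 1; -1]%Z);
  (15, 18, [:: 9; 15; 18; 21], [:: 1; -1; -1; 1]%Z);
  (15, 19, [:: 11; 15; 19; 21], [:: 1; -1; -1; 1]%Z);
  (15, 20, [:: 11; 15; 20; 23], [:: 1; -1; -1; 1]%Z);
  (15, 22, [:: 15; 16; 21; 22], [:: -2; 2; 1; -1]%Z);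
  (15, 23, [:: 14; 15; 21; 23; 25], [:: 2; -2; 1; -2; 1]%Z);
  (16, 18, [:: 10; 16; 18; 21], [:: 1; -1; -1; 1]%Z);
  (16, 19, [:: 3; 16; 19; 21], [:: 1; -2; -2; 3]%Z);
  (16, 24, [:: 14; 16; 24; 25], [:: 1; -1; -1; 1]%Z);
  (17, 20, [:: 15; 17; 20; 21], [:: 1; -1; -1; 1]%Z);
  (17, 21, [:: 16; 17; 21; 22], [:: 2; -2; -1; 1]%Z);
  (17, 23, [:: 12; 17; 23; 25], [:: 1; -1; -1; 1]%Z);
  (20, 25, [:: 20; 23; 25], [:: -1; 2; -1]%Z);
  (21, 24, [:: 21; 23; 24], [:: -1; 2; -1]%Z)]%N.

(* The first three entries are the cells around an edge of the knot, the next two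
   the cells that meet it only at its initial and at its final end. *)
Definition edge_certificates :
  seq (nat * nat * nat * nat * nat * int * int * seq (int * int)) := [::
  (3, 10, 21, 9, 12, 2%Z, 2%Z, [:: (-5, -8); (-1, -4); (1, 4); (1, 2)]%Z);
  (10, 12, 21, 3, 22, 4%Z, 1%Z, [:: (0, -8); (-4, 2); (0, 8); (0, 2)]%Z);
  (12, 21, 22, 10, 16, 2%Z, 1%Z, [:: (-6, 1); (0, 0); (8, -1); (2, 0)]%Z);
  (12, 16, 22, 21, 4, 4%Z, 1%Z, [:: (-8, 0); (-2, 4); (8, 0); (2, 0)]%Z);
  (4, 16, 22, 12, 17, 2%Z, 2%Z, [:: (-5, -8); (1, 4); (7, 12); (1, 2)]%Z);
  (4, 16, 17, 22, 7, 4%Z, 1%Z, [:: (-2, 0); (-2, 0); (0, -4); (0, 0)]%Z);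
  (4, 7, 16, 17, 5, 2%Z, 2%Z, [:: (-7, -7); (3, 5); (7, 7); (1, 1)]%Z);
  (4, 5, 16, 7, 3, 4%Z, 1%Z, [:: (0, -18); (-2, 8); (2, 8); (0, 2)]%Z);
  (3, 5, 16, 4, 6, 4%Z, 1%Z, [:: (0, -18); (-2, 8); (-2, 8); (0, 2)]%Z);
  (3, 6, 16, 5, 15, 2%Z, 2%Z, [:: (-7, -7); (3, 5); (1, 1); (1, 1)]%Z);
  (3, 6, 15, 16, 14, 2%Z, 1%Z, [:: (-1, -1); (-1, 1); (0, 0); (0, 0)]%Z);
  (3, 14, 15, 6, 21, 4%Z, 1%Z, [:: (-2, 0); (-2, 0); (0, -4); (0, 0)]%Z);
  (3, 14, 21, 15, 11, 2%Z, 2%Z, [:: (-5, -8); (1, 4); (-1, -4); (1, 2)]%Z);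
  (11, 14, 21, 3, 20, 4%Z, 1%Z, [:: (-8, 0); (-2, 4); (-8, 0); (2, 0)]%Z);
  (11, 20, 21, 14, 8, 2%Z, 1%Z, [:: (-6, 1); (0, 0); (-8, -1); (2, 0)]%Z);
  (8, 20, 21, 11, 19, 2%Z, 2%Z, [:: (-4, -1); (-4, -1); (-8, -5); (2, 1)]%Z);
  (8, 19, 21, 20, 18, 4%Z, 1%Z, [:: (-4, 2); (0, -8); (0, -8); (0, 2)]%Z);
  (8, 18, 21, 19, 9, 2%Z, 2%Z, [:: (-4, -1); (-8, -5); (-4, -1); (2, 1)]%Z);
  (8, 9, 18, 21, 0, 4%Z, 1%Z, [:: (0, -8); (0, -8); (-4, 2); (0, 2)]%Z);
  (0, 8, 9, 18, 3, 4%Z, 1%Z, [:: (-2, 0); (-2, 0); (0, -4); (0, 0)]%Z);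
  (0, 3, 9, 8, 10, 2%Z, 1%Z, [:: (-1, -1); (-1, 1); (0, 0); (0, 0)]%Z);
  (0, 3, 10, 9, 1, 2%Z, 2%Z, [:: (-7, -7); (-5, -3); (1, 1); (1, 1)]%Z);
  (1, 3, 10, 0, 4, 4%Z, 1%Z, [:: (-18, 0); (-8, 2); (8, -2); (2, 0)]%Z);
  (3, 4, 10, 1, 12, 2%Z, 2%Z, [:: (-7, -7); (-1, -1); (3, 5); (1, 1)]%Z);
  (3, 4, 12, 10, 16, 2%Z, 1%Z, [:: (-1, -1); (0, 0); (-1, 1); (0, 0)]%Z);
  (3, 12, 16, 4, 21, 4%Z, 1%Z, [:: (-2, -8); (0, -2); (-2, 8); (0, 2)]%Z);
  (3, 16, 21, 12, 15, 2%Z, 2%Z, [:: (-5, -8); (1, 4); (1, 4); (1, 2)]%Z);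
  (15, 16, 21, 3, 25, 4%Z, 1%Z, [:: (-8, 0); (8, 0); (-2, 4); (2, 0)]%Z);
  (15, 21, 25, 16, 14, 2%Z, 1%Z, [:: (-6, 1); (8, -1); (0, 0); (2, 0)]%Z);
  (14, 21, 25, 15, 23, 2%Z, 2%Z, [:: (-4, -1); (8, 3); (-4, -1); (2, 1)]%Z);
  (14, 23, 25, 21, 24, 4%Z, 1%Z, [:: (-4, 2); (0, 8); (0, -8); (0, 2)]%Z);
  (14, 23, 24, 25, 20, 4%Z, 1%Z, [:: (-4, 2); (0, 8); (0, -8); (0, 2)]%Z);
  (14, 20, 24, 23, 13, 2%Z, 2%Z, [:: (-4, -1); (8, 3); (-12, -7); (2, 1)]%Z);
  (13, 14, 20, 24, 2, 4%Z, 1%Z, [:: (-8, 0); (8, 0); (-18, 4); (2, 0)]%Z);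
  (2, 14, 20, 13, 11, 2%Z, 2%Z, [:: (-5, -8); (1, 4); (-7, -12); (1, 2)]%Z);
  (2, 11, 20, 14, 8, 2%Z, 1%Z, [:: (-1, -8); (0, 0); (-1, -10); (0, 2)]%Z);
  (2, 8, 11, 20, 3, 4%Z, 1%Z, [:: (-2, 0); (0, -4); (-2, 0); (0, 0)]%Z);
  (3, 8, 11, 2, 21, 4%Z, 1%Z, [:: (-2, 0); (0, -4); (2, 0); (0, 0)]%Z);
  (3, 8, 21, 11, 9, 2%Z, 2%Z, [:: (-5, -8); (-1, -4); (-1, -4); (1, 2)]%Z);
  (3, 9, 21, 8, 10, 2%Z, 1%Z, [:: (-1, -8); (1, -6); (0, 0); (0, 2)]%Z)]%N.

(* (u, v, P, m) gives the point P / m, in units of 1/8, in the relative interior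
   of the common face of the cells u and v. *)
Definition face_witnesses : seq (nat * nat * zpoint * nat) := [::
  (0, 9, (-5, -5, 0)%Z, 1); (3, 0, (-8, -4, 0)%Z, 1);
  (3, 9, (-5, -3, 0)%Z, 1); (9, 3, (-5, -3, 0)%Z, 1);
  (9, 21, (-3, -3, 0)%Z, 1); (21, 3, (-4, 0, 0)%Z, 1)]%N.

(** * Integer checks of the gallery and its certificates *)

Definition zcoord (P : zpoint) (j : nat) : int :=
  match j with 0%N => P.1.1 | 1%N => P.1.2 | _ => P.2 end.

Definition vertex (P : zpoint * zpoint * zpoint * zpoint) (c : color) : zpoint :=
  match c with colA => P.1.1.1 | colB => P.1.1.2 | colC => P.1.2 | colD => P.2 end.

Definition site s : affine := nth (0, 0, 0, 0) sites s.

(** Indices wrap around, so the gallery closes up and checks of consecutive pyramids include the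
    closing step. *)
Definition gal i := nth (0, 0, 0, (0, 0, 0), (0, 0, 0), (0, 0, 0)) gallery_pyramids (i %% 40).

(** The sum of four vertices in units of 1/2 is their barycenter in units of 1/8. *)
Definition bary i : zpoint := let: (a, b, c, d) := gal i in
  (a.1.1 + b.1.1 + c.1.1 + d.1.1, a.1.2 + b.1.2 + c.1.2 + d.1.2, a.2 + b.2 + c.2 + d.2).

(** Homogenized evaluation: [m] times the form at the rational point [P / m], which stays
    integral. *)
Definition eval_at (a : affine) (P : zpoint) (m : nat) : int :=
  a.1.1.1 * P.1.1 + a.1.1.2 * P.1.2 + a.1.2 * P.2 + a.2 * m%:Z.

Definition three : seq nat := [:: 0; 1; 2]%N.

Definition face_edge_ok (P : zpoint * zpoint * zpoint * zpoint) (a : nat) (e : bool) : bool :=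
  let x j := (zcoord (vertex P colA) j %/ 2)%Z in
  let y j := (zcoord (vertex P colB) j %/ 2)%Z in
  let z j := (zcoord (vertex P colD) j %/ 2)%Z in
  [&& all (fun j => [&& zcoord (vertex P colA) j == x j * 2,
             zcoord (vertex P colB) j == y j * 2,
             zcoord (vertex P colD) j == z j * 2 + 1,
             zcoord (vertex P colC) j == (if j == a then (z j + e%:Z) * 2 else z j * 2 + 1),
             (x j == z j) || (x j == z j + 1) &
             (y j == z j) || (y j == z j + 1)]) three,
      x a == z a + e%:Z, y a == z a + e%:Z,
      has (fun k => all (fun j => (x j != y j) == (j == k)) three) three,
      (2 %| x 0%N + (x 1%N + (x 2%N + 0)))%Z & ~~ (2 %| y 0%N + (y 1%N + (y 2%N + 0)))%Z].

Definition pyramid_ok P := has (fun a => has (face_edge_ok P a) [:: true; false]) three.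

Definition color_index c : nat := match c with colA => 0 | colB => 1 | colC => 2 | colD => 3 end%N.

Definition step_ok (s : color) (P Q : zpoint * zpoint * zpoint * zpoint) : bool :=
  all (fun c => (vertex Q c == vertex P c) == (color_index c != color_index s))
    [:: colA; colB; colC; colD].

Lemma gallery_ok : all (fun i => pyramid_ok (gal i) &&
  step_ok (nth colA gallery_word i) (gal i) (gal i.+1)) (iota 0 40).
Proof. by vm_compute. Qed.

Definition edge_cert i :=
  nth (0, 0, 0, 0, 0, (0 : int), (0 : int), [::])%N edge_certificates (i %% 40).
Definition edge_triple i : seq nat := let: (u, v, w, _, _, _, _, _) := edge_cert i in [:: u; v; w].

(* The difference of the forms [s] and [t] is positive on the half-open edge [i]
   and nonpositive on the edge [j]. *)
Definition separates i j s t : bool :=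
  let d k := eval_at (site s) (bary k) 1 - eval_at (site t) (bary k) 1 in
  [&& 0 < d i, 0 <= d i.+1, d j <= 0 & d j.+1 <= 0].

(** The forms of an edge's triple are maximal along that edge, so a difference of one form from each
    triple has the right weak signs; the search is for strictness at the start of edge [i]. *)
Definition separated i j : bool :=
  has (fun s => has (separates i j s) (edge_triple j)) (edge_triple i).

Lemma edges_separated :
  all (fun i => all (fun j => [|| i == j, separated i j | separated j i]) (iota 0 40)) (iota 0 40).
Proof. by vm_compute. Qed.

Lemma edges_nondegenerate :
  all (fun i => has (fun k => zcoord (bary i) k != zcoord (bary i.+1) k) three) (iota 0 40).
Proof. by vm_compute. Qed.

Definition max_at s (P : zpoint) m : bool :=
  all (fun t => eval_at t P m <= eval_at (site s) P m) sites.

(** This places the polygon in the 1-skeleton of the power diagram, so that open cells and relative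
    interiors of faces avoid it. *)
Lemma edges_on_triple_points : all (fun i => let T := edge_triple i in
  [&& uniq T, size T == 3%N, all (fun s => s < 26)%N T,
    all (fun s => max_at s (bary i) 1) T & all (fun s => max_at s (bary i.+1) 1) T]) (iota 0 40).
Proof. by vm_compute. Qed.

Definition comb (c : seq (nat * int)) : affine :=
  foldr (fun p => combine p.2 (site p.1)) (0, 0, 0, 0) c.
Definition coef_sum (c : seq (nat * int)) : int := foldr (fun p => +%R p.2) 0 c.

(* The nonnegative coefficients outside [a, b] add up to minus those at [a, b],
   so at a common point of both cells the combination is at most 0. *)
Definition disjointness_ok (d : nat * nat * seq nat * seq int) : bool :=
  let: (a, b, ss, ks) := d in let c := zip ss ks in
  [&& all (fun p => ((0 <= p.2) && (p.1 < 26)%N) || (p.1 \in [:: a; b])) c,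
    coef_sum c == 0, (comb c).1 == (0, 0, 0) & 0 < (comb c).2].

Lemma disjointness_certificates_ok : all disjointness_ok disjointness_certificates.
Proof. by vm_compute. Qed.

Definition unit_form (j : nat) (k : int) : affine :=
  (if j == 0%N then k else 0, if j == 1%N then k else 0, if j == 2%N then k else 0,
   if j == 3%N then k else 0).

(* With [x] in the cells [u], [v], [w], put [al = l * (M - f_t x)] and
   [be = l * (M - f_t' x)] where [M] is the maximum of the forms at [x]; the
   combinations say [k * 8 * x = be * bary i + al * bary i.+1] and [k = al + be]. *)
Definition edge_combination i j : seq (nat * int) :=
  let: (u, v, w, t, t', k, l, ks) := edge_cert i in
  let A := (nth (0, 0) ks j).1 in let B := (nth (0, 0) ks j).2 in
  let D := if (j < 3)%N then l * zcoord (bary i.+1) j else l in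
  let D' := if (j < 3)%N then l * zcoord (bary i) j else l in
  [:: (u, A); (v, B); (w, D + D' - A - B); (t, - D); (t', - D')].

Definition edge_ok i : bool :=
  let: (u, v, w, t, t', k, l, ks) := edge_cert i in
  [&& (t < 26)%N, (t' < 26)%N, 0 < k, 0 < l &
     all (fun j => comb (edge_combination i j) == unit_form j k) [:: 0; 1; 2; 3]%N].

Lemma edges_ok : all edge_ok (iota 0 40).
Proof. by vm_compute. Qed.

Definition cmul a b := nth 0%N (nth [::] code_table a) b.

Definition gcode (u v : nat) : nat := nth 0%N (nth [::] transition_table u) v.

Definition separated_cells (T : seq nat) : bool :=
  has (fun d : nat * nat * seq nat * seq int => (d.1.1.1 \in T) && (d.1.1.2 \in T))
    disjointness_certificates.
Definition crossed_triple (T : seq nat) : bool :=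
  has (fun i => all (mem T) (edge_triple i)) (iota 0 40).

(* [if] rather than [||]: call-by-value would evaluate both disjuncts. *)
Definition transition_ok u v w : bool :=
  if cmul (gcode u v) (gcode v w) == gcode u w then true
  else separated_cells [:: u; v; w] || crossed_triple [:: u; v; w].

Lemma transitions_ok : all (fun u => all (fun v => (gcode u v < 6)%N &&
  all (transition_ok u v) (iota 0 26)) (iota 0 26)) (iota 0 26).
Proof. by vm_compute. Qed.

(** The vertex that defines the site; the factor 4 converts units of 1/2 to units of 1/8. *)
Definition center s : zpoint := ((site s).1.1.1 * 4, (site s).1.1.2 * 4, (site s).1.2 * 4).

Definition strict_at s (P : zpoint) m : bool :=
  all (fun t => (t == s) || (eval_at (site t) P m < eval_at (site s) P m)) (iota 0 26).

Lemma centers_ok : all (fun s => strict_at s (center s) 1) (iota 0 26).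
Proof. by vm_compute. Qed.

Definition face_witness_ok (d : nat * nat * zpoint * nat) : bool :=
  let: (u, v, P, m) := d in
  [&& (0 < m)%N, (u < 26)%N, (v < 26)%N,
     eval_at (site u) P m == eval_at (site v) P m,
     all (fun t => [|| t == u, t == v |
        eval_at (site t) P m < eval_at (site u) P m]) (iota 0 26) &
     [&& gcode u u == 0, gcode v v == 0 & cmul (gcode v u) (gcode u v) == 0]%N].

Lemma face_witnesses_ok : all face_witness_ok face_witnesses.
Proof. by vm_compute. Qed.

(** * From integer data to real points *)

Lemma all_iota (P : nat -> bool) n i : all P (iota 0 n) -> (i < n)%N -> P i.
Proof. by move=> /allP H iN; apply: H; rewrite mem_iota. Qed.

Definition half_point (R : realType) (P : zpoint) : 'rV[R]_3 :=
  \row_j ((zcoord P j)%:~R / 2).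

Definition pyramid_of (R : realType) P : pyramid R := fun c => half_point R (vertex P c).

Definition eighth_point (R : realType) (P : zpoint) (m : nat) : 'rV[R]_3 :=
  \row_j ((zcoord P j)%:~R / (8 * m%:R)).

Lemma half_point_inj (R : realType) : injective (half_point R).
Proof.
move=> [[a b] c] [[a' b'] c'] /rowP H.
have eqj (j : 'I_3) : zcoord (a, b, c) j = zcoord (a', b', c') j.
  apply: (@intr_inj R); apply: (mulIf (_ : 2^-1 != 0)); first by rewrite invr_eq0 pnatr_eq0.
  by have := H j; rewrite !mxE.
by have /= -> := eqj 0; have /= -> := eqj 1; have /= -> := eqj 2.
Qed.

Lemma value_eighth (R : realType) a P m : (0 < m)%N ->
  m%:R * value a (eighth_point R P m) = (eval_at a P m)%:~R.
Proof.
move=> m0; have m0' : m%:R != 0 :> R by rewrite pnatr_eq0 -lt0n.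
rewrite /value /eval_at !mxE /= !rmorphD !rmorphM /= -pmulrn.
by field; rewrite m0'.
Qed.

Lemma bary_eighth (R : realType) i :
  barycenter (pyramid_of R (gal i)) = eighth_point R (bary i) 1.
Proof.
apply/rowP => j; rewrite /barycenter /pyramid_of /bary !mxE.
case: (gal i) => [[[[[a1 a2] a3] [[b1 b2] b3]] [[c1 c2] c3]] [[d1 d2] d3]] /=.
by case: j => [[|[|[|j]]]] //= _; rewrite !rmorphD /=; field.
Qed.

Lemma value_bary (R : realType) a i :
  value a (barycenter (pyramid_of R (gal i))) = (eval_at a (bary i) 1)%:~R.
Proof. by rewrite bary_eighth -(value_eighth R a (bary i) (ltn0Sn 0)) mul1r. Qed.

Lemma in_B3_pyramid_of (R : realType) P : pyramid_ok P -> in_B3 (pyramid_of R P).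
Proof.
case/hasP => a a3 /hasP[e _].
case/and5P => coords xa ya /hasP[k k3 diff] /andP[evx oddy].
have lt3 (i : nat) : i \in three -> (i < 3)%N by rewrite !inE => /or3P[]/eqP->.
have in3 (j : 'I_3) : (j : nat) \in three by case: j => [[|[|[|j]]]].
pose row (Q : zpoint) : 'rV[int]_3 := \row_j (zcoord Q j %/ 2)%Z.
(* Halving is exact for the colors A and B; for the odd coordinates of D it rounds down to the
   lowest corner of the cube. *)
pose x := row (vertex P colA); pose y := row (vertex P colB); pose z := row (vertex P colD).
have halfK (n : int) : (n * 2)%:~R / 2 = n%:~R :> R.
  by rewrite rmorphM /= mulfK.
exists z, (Ordinal (lt3 a a3)), e, x, y.
have cj (j : 'I_3) := allP coords _ (in3 j).
have corner (v : 'rV[int]_3) : v 0 (Ordinal (lt3 a a3)) = z 0 (Ordinal (lt3 a a3)) + e%:R ->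
   (forall j, (v 0 j == z 0 j) || (v 0 j == z 0 j + 1)) -> face_corner z (Ordinal (lt3 a a3)) e v.
  move=> va vj; split=> // j.
  by case/orP : (vj j) => /eqP; [left|right].
have natz_e : e%:Z = e%:R by rewrite natz.
split.
- split.
  + apply: corner; first by rewrite !mxE (eqP xa) -natz_e.
    by move=> j; have /and5P[_ _ _ _ /andP[xz _]] := cj j; rewrite !mxE.
  + apply: corner; first by rewrite !mxE (eqP ya) -natz_e.
    by move=> j; have /and5P[_ _ _ _ /andP[_ yz]] := cj j; rewrite !mxE.
  + rewrite (_ : [set j | _]%SET = [set Ordinal (lt3 k k3)]%SET) ?cards1 //.
    apply/setP => j; rewrite !inE !mxE.
    by have /eqP -> := allP diff _ (in3 j).
- by rewrite /even_point !big_ord_recl !big_ord0 !mxE evx oddy.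
- split; apply/rowP => j; rewrite /pyramid_of /half_point !mxE.
  + by have /and5P[/eqP/(congr1 (fun n : int => n%:~R / 2 : R)) + _ _ _ _] := cj j; rewrite halfK.
  + by have /and5P[_ /eqP/(congr1 (fun n : int => n%:~R / 2 : R)) + _ _ _] := cj j; rewrite halfK.
- apply/rowP => j; rewrite /pyramid_of /half_point !mxE.
  have /and5P[_ _ _ /eqP -> _] := cj j.
  rewrite -(inj_eq val_inj) /=; case: ifP => _; first by rewrite halfK rmorphD /= natz_e; case: (e).
  by rewrite rmorphD /= mulrDl halfK mul1r.
- apply/rowP => j; rewrite /pyramid_of /half_point !mxE.
  have /and5P[_ _ /eqP/(congr1 (fun n : int => n%:~R / 2 : R)) + _ _] := cj j.
  by rewrite rmorphD /= mulrDl halfK mul1r.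
Qed.

Lemma adjacent_pyramid_of (R : realType) s P Q : step_ok s P Q ->
  adjacent_across s (pyramid_of R P) (pyramid_of R Q).
Proof.
move=> H; have Hc c : (vertex Q c == vertex P c) == (color_index c != color_index s).
  by case/and5P : H => ? ? ? ? _; case: c.
split=> [/half_point_inj/eqP|c cs].
  by rewrite (eqP (Hc s)) eqxx.
by congr half_point; apply/eqP; rewrite (eqP (Hc c)); case: c s cs {H Hc} => -[].
Qed.

Lemma gal_closed_gallery (R : realType) :
  closed_gallery gallery_word (fun i => pyramid_of R (gal i)).
Proof.
have gal_mod i : gal i = gal (i %% 40) by rewrite /gal modn_mod.
split=> //; split=> i.
  move=> _; rewrite gal_mod.
  by have /andP[/in_B3_pyramid_of ? _] := all_iota gallery_ok (ltn_pmod i (isT : 0 < 40)%N).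
by move=> i40; have /andP[_ /adjacent_pyramid_of] := all_iota gallery_ok i40; apply.
Qed.

(** * The polygon inside the power diagram *)

Section TheKnot.
Variable R : realType.
Local Notation V := 'rV[R]_3.
Let b (i : nat) : V := barycenter (pyramid_of R (gal i)).
Let K : set V := polygon 40 b.

Lemma value_edge a i (t : R) : value a (edge_point b i t) =
  (1 - t) * (eval_at a (bary i) 1)%:~R + t * (eval_at a (bary i.+1) 1)%:~R.
Proof. by rewrite /edge_point value_line !value_bary. Qed.

Lemma separates_disjoint i j s s' (t u : R) : separates i j s s' ->
  0 <= t < 1 -> 0 <= u < 1 -> edge_point b i t <> edge_point b j u.
Proof.
case/and4P => Hi Hi' Hj Hj' /andP[t0 t1] /andP[u0 u1] E.
have := congr1 (fun p => value (site s) p - value (site s') p) E.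
rewrite !value_edge.
set si := eval_at (site s) (bary i) 1 in Hi *; set si' := eval_at (site s) (bary i.+1) 1 in Hi' *.
set sj := eval_at (site s) (bary j) 1 in Hj *; set sj' := eval_at (site s) (bary j.+1) 1 in Hj' *.
move: Hi Hi' Hj Hj'; rewrite -(ltr0z R) -(ler0z R) -!(lerz0 R) !rmorphB /= => Hi Hi' Hj Hj'.
have := mulr_gt0 (_ : 0 < 1 - t) Hi; rewrite subr_gt0 => /(_ t1).
have := mulr_ge0 t0 Hi'.
have := mulr_le0 Hj; have := mulr_ge0_le0 (_ : 0 <= 1 - u) Hj; rewrite subr_ge0 => /(_ (ltW u1)).
have := mulr_ge0_le0 u0 Hj'.
lra.
Qed.

(** Distinct edges are kept apart by a difference of two forms; along a single edge some coordinate
    is strictly monotone. *)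
Lemma knot_simple : simple_closed_polygon 40 b.
Proof.
split=> // i j t u i40 j40 It Iu E.
have := all_iota (all_iota edges_separated i40) j40.
case/or3P => [/eqP ij|/hasP[s _ /hasP[s' _ /separates_disjoint H]]|
    /hasP[s _ /hasP[s' _ /separates_disjoint H]]].
- split=> //; subst j.
  have [k _ bk] := hasP (all_iota edges_nondegenerate i40).
  pose a : affine := unit_form (if k is 0 then 0 else if k is 1 then 1 else 2)%N 1.
  have := congr1 (value a) E; rewrite !value_edge.
  have ev P : eval_at a P 1 = zcoord P k.
    by rewrite /a /eval_at; case: k {bk a} => [|[|k]] /=; ring.
  rewrite !ev => /eqP; rewrite -subr_eq0.
  have -> (p q : R) : (1 - t) * p + t * q - ((1 - u) * p + u * q) = (t - u) * (q - p) by ring.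
  rewrite mulf_eq0 !subr_eq0 (eqr_int R) => /orP[/eqP //|/eqP qp].
  by rewrite qp eqxx in bk.
- by case: (H _ _ It Iu E).
- by case: (H _ _ Iu It (esym E)).
Qed.

(** The endpoint left out of an edge is the initial point of the next one, cyclically. *)
Lemma polygon_closed_edge i (t : R) : (i < 40)%N -> 0 <= t <= 1 -> K (edge_point b i t).
Proof.
move=> i40 /andP[t0]; rewrite le_eqVlt => /predU1P[->|t1]; last first.
  by exists i, t; rewrite t0.
have -> : edge_point b i 1 = b i.+1 by rewrite /edge_point subrr scale0r add0r scale1r.
have ep0 k : edge_point b k 0 = b k by rewrite /edge_point subr0 scale1r scale0r addr0.
have [i39|i39] := ltnP i.+1 40.
  by exists i.+1, 0; rewrite lexx ltr01 ep0.
have -> : i.+1 = 40%N by lia.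
by exists 0%N, 0; rewrite lexx ltr01 ep0.
Qed.

Local Notation in_cell := (@in_cell R sites).
Local Notation in_open_cell := (@in_open_cell R sites).
Local Notation fval s x := (value (site s) x).

Lemma in_cell_combine s i (t : R) : (s < 26)%N -> 0 <= t <= 1 ->
  max_at s (bary i) 1 -> max_at s (bary i.+1) 1 -> in_cell s (edge_point b i t).
Proof.
move=> s26 /andP[t0 t1] m m'; split=> // r r26; rewrite -/(site r) -/(site s) !value_edge.
have mem_r := mem_nth (0, 0, 0, 0) (r26 : (r < size sites)%N).
have H : ((eval_at (site r) (bary i) 1)%:~R <= (eval_at (site s) (bary i) 1)%:~R :> R).
  by rewrite ler_int; exact: (allP m _ mem_r).
have H' : ((eval_at (site r) (bary i.+1) 1)%:~R <= (eval_at (site s) (bary i.+1) 1)%:~R :> R).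
  by rewrite ler_int; exact: (allP m' _ mem_r).
by apply: lerD; apply: ler_wpM2l; rewrite ?subr_ge0.
Qed.

Lemma knot_triple x : K x -> exists T : seq nat, [/\ uniq T, size T = 3%N &
  forall s, s \in T -> in_cell s x].
Proof.
case=> i [t [i40 /andP[t0 t1] ->]]; exists (edge_triple i).
have /and5P[uT /eqP sT /allP T26 /allP Tm /allP Tm'] := all_iota edges_on_triple_points i40.
split=> // s sT'; apply: in_cell_combine; rewrite ?t0 ?ltW //;
  by [exact: T26|exact: Tm|exact: Tm'].
Qed.

Lemma not_in_knot x u v : (forall s, in_cell s x -> s = u \/ s = v) -> ~ K x.
Proof.
move=> uv /knot_triple[T [uT sT Tx]].
have : (size T <= size [:: u; v])%N.
  by apply: uniq_leq_size => // s /Tx/uv[]->; rewrite !inE eqxx ?orbT.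
by rewrite sT.
Qed.

Lemma open_cell_not_in_knot s x : in_open_cell s x -> ~ K x.
Proof.
move=> [s26 Hs]; apply: (@not_in_knot x s s) => r [r26 Hr]; left.
apply/eqP/negPn/negP => /eqP rs; have := Hs r r26 rs.
by rewrite ltNge Hr.
Qed.

Lemma comb_le (c : seq (nat * int)) x (M : R) :
  (forall p, p \in c -> p.2%:~R * fval p.1 x <= p.2%:~R * M) ->
  value (comb c) x <= (coef_sum c)%:~R * M.
Proof.
elim: c => [|p c IHc] H /=.
  by rewrite /value /= !mul0r !addr0.
rewrite value_combine rmorphD /= mulrDl; apply: lerD; first by apply: H; rewrite mem_head.
by apply: IHc => q qc; apply: H; rewrite in_cons qc orbT.
Qed.

Lemma disjoint_cells d x : disjointness_ok d ->
  in_cell d.1.1.1 x -> in_cell d.1.1.2 x -> False.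
Proof.
case: d => [[[p q] ss] ks] /= /and4P[coefs /eqP sum0 /eqP lin0 cst] [p26 px] [q26 qx].
have pq : fval p x = fval q x by apply: le_anti; rewrite px // qx.
have := @comb_le (zip ss ks) x (fval p x).
rewrite sum0 mul0r.
have -> : value (comb (zip ss ks)) x = (comb (zip ss ks)).2%:~R.
  by case: (comb _) lin0 => a k /= ->; rewrite /value /= !mul0r !add0r.
rewrite lerz0 leNgt cst => H; suff : false by []; apply: H => r rc.
have := allP coefs _ rc; case/orP => [/andP[r0 r26]|].
  by apply: ler_wpM2l; [rewrite ler0z|exact: px].
by rewrite !inE => /orP[]/eqP -> //; rewrite pq.
Qed.

(** After division by [k], the numbers [al] and [be] are the barycentric coordinates of [x] on edge
    [i]. They are nonnegative because the three forms of the triple attain the maximum at [x]. *)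
Lemma crossed_in_knot i x : (i < 40)%N ->
  (forall s, s \in edge_triple i -> in_cell s x) -> K x.
Proof.
move=> i40; have := all_iota edges_ok i40.
rewrite /edge_ok /edge_triple /edge_combination.
case: (edge_cert i) => [[[[[[[u v] w] t] t'] k] l] ks] /and5P[t26 t'26 k0 l0 /allP H] inT.
have [u26 ux] : in_cell u x by apply: inT; rewrite !inE eqxx.
have [v26 vx] : in_cell v x by apply: inT; rewrite !inE eqxx orbT.
have [w26 wx] : in_cell w x by apply: inT; rewrite !inE eqxx !orbT.
have uv : fval v x = fval u x by apply: le_anti; rewrite ux // vx.
have uw : fval w x = fval u x by apply: le_anti; rewrite ux // wx.
pose al := l%:~R * (fval u x - fval t x); pose be := l%:~R * (fval u x - fval t' x).
have l0' : 0 <= l%:~R :> R by rewrite ler0z ltW.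
have al0 : 0 <= al by apply: mulr_ge0; rewrite ?subr_ge0 // ux.
have be0 : 0 <= be by apply: mulr_ge0; rewrite ?subr_ge0 // ux.
have k0' : 0 < k%:~R :> R by rewrite ltr0z.
have comb_val (A B D D' : int) :
    value (comb [:: (u, A); (v, B); (w, D + D' - A - B); (t, - D); (t', - D')]) x =
    D%:~R * (fval u x - fval t x) + D'%:~R * (fval u x - fval t' x).
  rewrite /= !value_combine uv uw !rmorphB !rmorphD !rmorphN /=.
  by rewrite [value (0, 0, 0, 0) x]/value /= !mul0r; ring.
have kE : k%:~R = al + be.
  have /eqP/(congr1 (fun a => value a x)) := H 3%N isT; rewrite comb_val /= => E.
  by rewrite /al /be E /unit_form /value /= !mul0r !add0r.
have xE (j : 'I_3) : k%:~R * (8 * x 0 j) =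
    al * (zcoord (bary i.+1) j)%:~R + be * (zcoord (bary i) j)%:~R.
  have j4 : (j : nat) \in [:: 0; 1; 2; 3]%N by case: j => [[|[|[|j]]]].
  have /eqP/(congr1 (fun a => value a x)) := H j j4.
  rewrite ltn_ord comb_val !rmorphM /= => E.
  transitivity (value (unit_form j k) x); last by rewrite -E /al /be; ring.
  by rewrite /unit_form /value; case: j {j4 E} => [[|[|[|j]]]] //= j3;
     rewrite !mul0r ?add0r ?addr0; congr (_ * (_ * x _ _)); exact: val_inj.
have -> : x = edge_point b i (al / k%:~R).
  apply/rowP => j; apply: (mulfI (lt0r_neq0 k0')).
  have -> : k%:~R * x 0 j = k%:~R * (8 * x 0 j) / 8 by field.
  have beE : be = k%:~R - al by rewrite kE addrAC subrr add0r.
  rewrite xE /edge_point /b !bary_eighth !mxE beE.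
  by field; rewrite lt0r_neq0.
apply: polygon_closed_edge => //.
by rewrite divr_ge0 ?(ltW k0') //= ler_pdivrMr // mul1r kE lerDl.
Qed.

(** * The S_3-valued cocycle and its holonomies *)

Local Notation gT := {perm 'I_3}.

Definition code_perm (k : nat) : gT := let s : gT := tperm 0 1 in let t : gT := tperm 1 2 in
  nth 1%g [:: 1; s; t; s * t; t * s; s * t * s]%g k.

(** The Coxeter relations of S_3, two involutions and the braid relation, reduce all 36 products. *)
Lemma code_permM i j : (i < 6)%N -> (j < 6)%N ->
  (code_perm i * code_perm j)%g = code_perm (cmul i j).
Proof.
rewrite /code_perm; set s : gT := tperm 0 1; set t : gT := tperm 1 2.
have braid : (t * s * t = s * t * s)%g.
  by apply/permP => -[[|[|[|k]]] k3] //; apply: val_inj; rewrite !permE /= !permE /= ?permE.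
have [ss tt] : (s * s = 1)%g /\ (t * t = 1)%g by rewrite !tperm2.
have ssK p : (p * s * s = p)%g by rewrite -mulgA ss mulg1.
have ttK p : (p * t * t = p)%g by rewrite -mulgA tt mulg1.
have braidK p : (p * t * s * t = p * s * t * s)%g.
  by rewrite -!mulgA; congr (_ * _)%g; rewrite !mulgA.
case: i => [|[|[|[|[|[|]]]]]] // _; case: j => [|[|[|[|[|[|]]]]]] // _;
  rewrite /cmul /= ?mulg1 ?mul1g ?mulgA //;
  by do 4?rewrite ?ss ?tt ?ssK ?ttK ?mul1g ?braid ?braidK.
Qed.

Definition transition u v : gT := code_perm (gcode u v).

(** A triple that violates the identity in the table cannot occur here: either two of its cells are
    disjoint, or it surrounds an edge of the knot and its common points lie on [K]. *)
Lemma transition_cocycle u v w x : in_cell u x -> in_cell v x -> in_cell w x -> ~ K x ->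
  (transition u v * transition v w)%g = transition u w.
Proof.
move=> ux vx wx Kx; have [u26 _] := ux; have [v26 _] := vx; have [w26 _] := wx.
have inT s : s \in [:: u; v; w] -> in_cell s x by rewrite !inE => /or3P[]/eqP->.
have /andP[c1 /(all_iota (i := w))] := all_iota (all_iota transitions_ok u26) v26.
have /andP[c2 _] := all_iota (all_iota transitions_ok v26) w26.
move/(_ w26); rewrite /transition_ok; case: eqP =>
  [E _|_ /orP[/hasP[d dcert /andP[d1 d2]]|/hasP[i]]].
- by rewrite /transition code_permM // E.
- by case: (disjoint_cells (allP disjointness_certificates_ok _ dcert) (inT _ d1) (inT _ d2)).
- rewrite mem_iota => /andP[_ i40] /allP H; case: Kx.
  by apply: (crossed_in_knot i40) => s /H; exact: inT.
Qed.

Lemma value_lt (s t : nat) P m : (0 < m)%N ->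
  (eval_at (site t) P m < eval_at (site s) P m) =
  (fval t (eighth_point R P m) < fval s (eighth_point R P m)).
Proof.
by move=> m0; rewrite -[RHS](ltr_pM2l (_ : 0 < m%:R)) ?ltr0n // !value_eighth // ltr_int.
Qed.

Lemma center_in_open_cell s : (s < 26)%N -> in_open_cell s (eighth_point R (center s) 1).
Proof.
move=> s26; split=> // t t26 ts.
have /orP[/eqP //|] := all_iota (all_iota centers_ok s26) t26.
by rewrite value_lt.
Qed.

Lemma knot_is_knotted : ~ ambient_isotopic K (@unknot R).
Proof.
move=> iso; have [label labelP] := @label_exists R sites isT.
have [c [f Hf]] := isotopic_unknot_section iso (label_cocycle transition_cocycle labelP).
pose F s := f (eighth_point R (center s) 1).
have edge u v P m : (u, v, P, m) \in face_witnesses ->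
    (F u * transition u v * (F v)^-1)%g \in <[c]>%g.
  move=> /(allP face_witnesses_ok _)/and5P[].
  move=> m0 u26 v26 /eqP uv /andP[lt_uv /and3P[/eqP guu /eqP gvv /eqP gvu]].
  set p := eighth_point R P m.
  have uvE : fval u p = fval v p.
    apply: (mulfI (_ : m%:R != 0)); first by rewrite pnatr_eq0 -lt0n.
    by rewrite !value_eighth // uv.
  have max_p t : (t < 26)%N -> [\/ t = u, t = v | fval t p < fval u p].
    move=> t26; have /or3P[/eqP->|/eqP->|] := all_iota lt_uv t26.
    - by constructor 1.
    - by constructor 2.
    - by rewrite value_lt //; constructor 3.
  have up : in_cell u p.
    by split=> // t /max_p[->|->|/ltW]; rewrite -/(site _) ?uvE.
  have vp : in_cell v p.
    by split=> // t t26; rewrite -/(site _) -/(site v) -uvE; apply up.2.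
  have uvp t : in_cell t p -> t = u \/ t = v.
    case=> t26 Ht; have [->|->|] := max_p t t26; [by left|by right|].
    by rewrite ltNge Ht.
  have one k : gcode k k = 0%N -> transition k k = 1%g by rewrite /transition => ->.
  apply: (crossing_transition labelP Hf (p := p)) => //; try exact: one.
  - have /andP[c1 _] := all_iota (all_iota transitions_ok u26) v26.
    have /andP[c2 _] := all_iota (all_iota transitions_ok v26) u26.
    by rewrite /transition code_permM // gvu.
  - by move=> z; exact: open_cell_not_in_knot.
  - by move=> z; exact: open_cell_not_in_knot.
  - exact: center_in_open_cell.
  - exact: center_in_open_cell.
  - exact: not_in_knot uvp.
(* Around a closed loop of three cells the intermediate values of [F] cancel, leaving the holonomy
   conjugated by [F u]. *)
have path3 u v w k : (u, v) \in [seq d.1.1 | d <- face_witnesses] ->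
    (v, w) \in [seq d.1.1 | d <- face_witnesses] ->
    (w, u) \in [seq d.1.1 | d <- face_witnesses] ->
    (transition u v * transition v w * transition w u)%g = code_perm k ->
    (F u * code_perm k * (F u)^-1)%g \in <[c]>%g.
  have edge' q r : (q, r) \in [seq d.1.1 | d <- face_witnesses] ->
      (F q * transition q r * (F r)^-1)%g \in <[c]>%g.
    by case/mapP => -[[[q' r'] P] m] /edge H [-> ->].
  move=> /edge' uv /edge' vw /edge' wu <-.
  by have := groupM (groupM uv vw) wu; rewrite !mulgA !mulgKV.
(* The cells 3, 0, 9 surround one edge of the knot and 3, 9, 21 another. Both loops start in cell 3,
   so the holonomies (0 1) and (1 2) are conjugated by the same element. *)
have S1 : (F 3%N * code_perm 1 * (F 3%N)^-1)%g \in <[c]>%g.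
  apply: (@path3 3 0 9 1)%N => //.
  by rewrite /transition !code_permM.
have S2 : (F 3%N * code_perm 2 * (F 3%N)^-1)%g \in <[c]>%g.
  apply: (@path3 3 9 21 2)%N => //.
  by rewrite /transition !code_permM.
(* Cancelling the conjugation would make (0 1) and (1 2) commute, but their two products differ at
   0. *)
have := centsP (cycle_abelian c) _ S1 _ S2.
rewrite /commute !mulgA !mulgKV => /mulIg; rewrite -!mulgA => /mulgI.
move/permP => /(_ 0); rewrite !permE /= !permE /=.
by [].
Qed.

End TheKnot.

Theorem theorem1 (R : realType) :
  exists l : nat, is_min_stick_number R l /\ (l <= 40)%N.
Proof.
(* Well-ordering is used twice: the explicit gallery bounds the stick number of [K], and that number
   bounds the minimum over all nontrivial knots. *)
have min_exists (S : set nat) n : S n -> exists m, is_min S m /\ (m <= n)%N.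
  move=> Sn; have exS : exists m, `[< S m >] by exists n; apply/asboolP.
  case: (ex_minnP exS) => m /asboolP Sm minm.
  exists m; split; last by apply: minm; apply/asboolP.
  by split=> // k Sk; apply: minm; apply/asboolP.
pose b i := barycenter (pyramid_of R (gal i)); pose K := polygon 40 b.
(* [K] is the polygon itself, so the constant isotopy shows both that it is tame and that the
   gallery knots as [K]. *)
have iso_refl : ambient_isotopic K K.
  exists (fun _ x => x); split=> //; last by rewrite image_id.
    apply: continuous_subspaceT => tx; exact: cvg_snd.
  by move=> t _; split; [|exists id; split] => // x; exact: cvg_id.
have nontriv : nontrivial_knot K.
  by split; [exists 40%N, b; split=> //; exact: knot_simple|exact: knot_is_knotted].
have [m [minm m40]] : exists m, is_stick_number K m /\ (m <= 40)%N.
  apply: min_exists; exists gallery_word, (fun i => pyramid_of R (gal i)).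
  by split=> //; [exact: gal_closed_gallery|split=> //; exact: knot_simple].
have [l [minl lm]] : exists l, is_min_stick_number R l /\ (l <= m)%N.
  by apply: min_exists; exists K.
by exists l; split=> //; exact: leq_trans m40.
Qed.
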